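(* Let $\phi\colon\omega\to\mathbb{R}^+$ be injective with $\inf\operatorname{rg}(\phi)>0$, and suppose that $\operatorname{rg}(\phi)$, ordered by the usual order of the reals, has order type $\omega^*$ (the reverse of $\omega$). Then the $\mathsf L(d_\phi)$-hierarchy on the Borel subsets of $\omega^\omega$ is very good.
   Context: Work in ZF + DC($\mathbb{R}$). $\bar d$ is the usual ultrametric on $\omega^\omega$ ($\bar d(x,y)=2^{-n}$, $n$ least with $x(n)\ne y(n)$; $0$ if $x=y$). $d_\phi(x,y)=\max\{\phi(x(0)),\phi(y(0))\}\cdot\bar d(x,y)$, a complete ultrametric compatible with the product topology. $\mathsf L(d_\phi)$: maps $f\colon\omega^\omega\to\omega^\omega$ with $d_\phi(f(x),f(y))\le d_\phi(x,y)$. $A\le B$ iff $A=f^{-1}(B)$ for some $f\in\mathsf L(d_\phi)$; $A<B$ iff $A\le B$, $B\not\le A$; $\neg A$ is the complement. Very good on Borel sets: (i) for all Borel $A,B$, $A\le B$ or $\neg B\le A$, and (ii) no sequence of Borel sets with $A_{n+1}<A_n$ for all $n$. *)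

(* Defs.v *)
From HB Require Import structures.
From mathcomp Require Import all_boot all_order all_algebra.
From mathcomp Require Import all_classical all_reals all_analysis.

Set Implicit Arguments.
Unset Strict Implicit.
Unset Printing Implicit Defensive.

Import Order.TTheory GRing.Theory Num.Theory.
Local Open Scope classical_set_scope.
Local Open Scope ring_scope.

(* nat carries the discrete topology, so this is Baire space with its product
   topology. *)
Definition baire_space : Type := prod_topology (fun _ : nat => nat).

HB.instance Definition _ := Pointed.on baire_space.
HB.instance Definition _ := Topological.on baire_space.

Definition borel_set (A : set baire_space) : Prop :=
  <<s (@open baire_space) >> A.

Definition dbar (R : realType) (x y : baire_space) : R :=
  match pselect (exists n : nat, x n != y n) with
  | left ex_diff => 2 ^- ex_minn ex_diff
  | right _ => 0
  end.

Definition dphi (R : realType) (phi : nat -> R) (x y : baire_space) : R :=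
  Num.max (phi (x 0%N)) (phi (y 0%N)) * dbar R x y.

Definition nonexpansive (R : realType) (phi : nat -> R)
    (f : baire_space -> baire_space) : Prop :=
  forall x y, dphi phi (f x) (f y) <= dphi phi x y.

Definition reducible (R : realType) (phi : nat -> R)
    (A B : set baire_space) : Prop :=
  exists f : baire_space -> baire_space, nonexpansive phi f /\ A = f @^-1` B.

Definition strictly_reducible (R : realType) (phi : nat -> R)
    (A B : set baire_space) : Prop :=
  reducible phi A B /\ ~ reducible phi B A.

Definition very_good_on_borel (R : realType) (phi : nat -> R) : Prop :=
  (forall A B : set baire_space, borel_set A -> borel_set B ->
     reducible phi A B \/ reducible phi (~` B) A) /\
  ~ (exists A : nat -> set baire_space,
       (forall n, borel_set (A n)) /\
       (forall n, strictly_reducible phi (A n.+1) (A n))).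

(* e is an order isomorphism from (nat, >) onto (X, <). *)
Definition order_type_omega_star (R : realType) (X : set R) : Prop :=
  exists e : nat -> R,
    set_bij [set: nat] X e /\ forall m n : nat, (e m < e n) = (n < m)%N.

(* Main.v *)
(** Let [r] be the infimum of [phi]. Two points at distance at most [r] share an
    initial word, and the words form a discrete space with distances of order type
    omega*. A nonexpansive map is a nonexpansive map of words together with, for each
    word, a map of tails which is Lipschitz or contracting for the standard metric,
    depending on the two words. For tails, semilinear ordering is Wadge's lemma,
    hence follows from Borel determinacy, which is proved by Martin's unravelling of
    Borel games. The words are treated by a game in which the players name shrinking
    balls of words: if II has no winning position, then I can answer every word [v]
    by a word [G v] whose tail set does not reduce to that of [v], with [G]
    contracting.

    For well-foundedness we use the Martin-Monk argument: along a descending sequence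
    player I wins both Lipschitz games of each consecutive pair, and filling in the
    infinite board according to [z] in the Cantor space yields a Borel set of [z]
    flipped by every change of one bit, against the Baire category theorem. Since
    the space is not spherically complete, the board could fail to converge on words;
    it converges because I's strategies can be chosen not to stay forever in the
    balls around the missing point. *)

Require Import Defs.
From mathcomp Require Import all_boot all_order all_algebra finmap zify lra.
From mathcomp Require Import all_classical all_reals all_analysis.

Set Implicit Arguments.
Unset Strict Implicit.
Unset Printing Implicit Defensive.

Import Order.TTheory GRing.Theory Num.Theory.
Local Open Scope classical_set_scope.

(** * Games on trees *)

(** Above [r] every word is isolated after finitely many shrinking balls. Within a word with first
    letter [a] the metric is the standard one scaled by the unit [phi a * 2 ^- N a]. All units lie
    between [r / 2] and [r], so passing from one word to another costs a tail map at most one step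
    of contraction; this is why only the two dual alternatives of Wadge's lemma occur. The word game
    itself needs no determinacy theorem, since a run is judged only once II's balls have shrunk to
    one word. A run that stays in the cones forever names no word and has no winner: harmless for a
    single reduction, but it could leave a row of the infinite board without a point, whence the
    extra property [leaving]. Tails raise a second obstacle there: strategies of I contract tails
    only where the isolation level of the word does not increase, so convergence also rests on the
    impossibility of an infinite strict descent of these levels along the rows. *)

(* A pruned tree, flattened: nodes with their level and parent ([par] of the
   root is the root). Player I ([false]) moves at even levels. *)
Record tree := Tree {
  car :> Type;
  lv : car -> nat;
  par : car -> car;
  root : car;
  lv_root : lv root = 0;
  root_uniq : forall t, lv t = 0 -> t = root;
  lv_par : forall t, lv (par t) = (lv t).-1;
  child_ex : forall t, exists s, par s = t /\ lv s = (lv t).+1 }.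

Section Tree.
Variable T : tree.
Implicit Types (s t u : T) (x : nat -> T) (G : T -> Prop) (f : T -> T).

Definition child t s := par s = t /\ lv s = (lv t).+1.
Definition branch x := (forall n, lv (x n) = n) /\ forall n, par (x n.+1) = x n.
(* A strategy is defined at every node; the values at the opponent's nodes are
   irrelevant. *)
Definition strat f := forall t, child t (f t).
Definition follows (b : bool) f x := forall n, odd n = b -> x n.+1 = f (x n).
Definition anc m t := iter (lv t - m) (@par T) t.

Definition dchild t : T := sval (cid (child_ex t)).
Lemma dchildP : strat dchild.
Proof. by move=> t; exact: (svalP (cid (child_ex t))). Qed.

Definition fixc t s := if pselect (child t s) then s else dchild t.
Lemma fixcP t s : child t (fixc t s).
Proof. by rewrite /fixc; case: pselect => //= _; exact: dchildP. Qed.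
Lemma fixc_id t s : child t s -> fixc t s = s.
Proof. by rewrite /fixc; case: pselect => //=. Qed.

Lemma branch_child x n : branch x -> child (x n) (x n.+1).
Proof. by case=> limpt xp; split; rewrite ?limpt. Qed.

Lemma lv_anc m t : m <= lv t -> lv (anc m t) = m.
Proof.
rewrite /anc => mt; have -> : m = lv t - (lv t - m) by lia.
have H : forall k, lv (iter k (@par T) t) = lv t - k.
  by elim=> [|k IH] /=; [lia | rewrite lv_par IH; lia].
by rewrite H; lia.
Qed.

Lemma anc_id t : anc (lv t) t = t.
Proof. by rewrite /anc subnn. Qed.

Lemma anc_par m t : m < lv t -> anc m (par t) = anc m t.
Proof.
move=> mt; rewrite /anc lv_par.
have -> : lv t - m = ((lv t).-1 - m).+1 by lia.
by rewrite iterSr.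
Qed.

Lemma anc_child m t s : child t s -> m <= lv t -> anc m s = anc m t.
Proof. by move=> [e ls] mt; rewrite -e anc_par //; lia. Qed.

Lemma anc_branch x m n : branch x -> m <= n -> anc m (x n) = x m.
Proof.
move=> bx; elim: n => [|n IH] mn.
  have -> : m = 0 by lia.
  by rewrite -{1}(bx.1 0) anc_id.
case: (eqVneq m n.+1) => [->|ne]; first by rewrite -{1}(bx.1 n.+1) anc_id.
rewrite (anc_child (branch_child n bx)) ?IH //; rewrite ?bx.1; lia.
Qed.

Lemma anc_anc i m t : i <= m -> m <= lv t -> anc i (anc m t) = anc i t.
Proof.
move=> im mt; rewrite {1}/anc lv_anc // /anc -iterD; congr iter; lia.
Qed.

Lemma branch_agree x y m n : branch x -> branch y -> x n = y n -> m <= n -> x m = y m.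
Proof. by move=> bx By e mn; rewrite -(anc_branch bx mn) e anc_branch. Qed.

(** A least fixed point in place of ordinal ranks: a derivation is a well-founded tree of forced
    play, and induction on it builds the strategy. *)
Inductive win (b : bool) G : T -> Prop :=
| win_base t : G t -> win b G t
| win_own t s : odd (lv t) = b -> child t s -> win b G s -> win b G t
| win_opp t : odd (lv t) = ~~ b -> (forall s, child t s -> win b G s) -> win b G t.

Definition reaches b G t f := forall x, branch x -> x (lv t) = t ->
  (forall n, lv t <= n -> odd n = b -> x n.+1 = f (x n)) ->
  exists n, lv t <= n /\ G (x n).

Lemma win_reaches b G t : win b G t -> exists f, strat f /\ reaches b G t f.
Proof.
elim=> {t} [t Gt|t s ot ts _ [f [sf rf]]|t ot ws IH].
- exists dchild; split; first exact: dchildP.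
  by move=> x bx xt _; exists (lv t); rewrite xt.
- exists (fun v => if pselect (v = t) then s else f v); split.
    by move=> v; case: pselect => /= [->|_]; [exact: ts|exact: sf].
  move=> x bx xt fx.
  have xs : x (lv s) = s.
    by rewrite ts.2 fx // xt; case: pselect => //=.
  have [|n [ln Gn]] := rf x bx xs.
    move=> n ln on; rewrite fx //; last by move: ln; rewrite ts.2; lia.
    case: pselect => //= e; move: ln; rewrite -(bx.1 n) e ts.2; lia.
  by exists n; split=> //; move: ln; rewrite ts.2; lia.
- have /choice[F HF] : forall s, exists g, child t s -> strat g /\ reaches b G s g.
    move=> s; case: (pselect (child t s)) => ts.
      by have [f Hf] := IH s ts; exists f.
    by exists dchild.
  exists (fun v => if pselect (child t (anc (lv t).+1 v)) then F (anc (lv t).+1 v) v else dchild v).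
  split.
    move=> v; case: pselect => /= [c|_]; last exact: dchildP.
    exact: (HF _ c).1.
  move=> x bx xt fx.
  have c : child t (x (lv t).+1) by have := branch_child (lv t) bx; rewrite xt.
  have [|n ln on|n [ln Gn]] := (HF _ c).2 x bx.
  + by rewrite bx.1.
  + rewrite bx.1 in ln; rewrite fx //; last lia.
    by rewrite anc_branch //; case: pselect => //=.
  + by exists n; split=> //; move: ln; rewrite bx.1; lia.
Qed.

Definition wstrat b G t : T -> T :=
  match pselect (exists f, strat f /\ reaches b G t f) with
  | left e => sval (cid e) | right _ => dchild end.
Lemma wstrat_strat b G t : strat (wstrat b G t).
Proof. rewrite /wstrat; case: pselect => /= [e|_]; last exact: dchildP. by case: cid => f []. Qed.
Lemma wstratP b G t : win b G t -> reaches b G t (wstrat b G t).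
Proof.
move=> w; rewrite /wstrat; case: pselect => /= [e|[]]; last exact: win_reaches.
by case: cid => f [].
Qed.

Lemma nwin_own b G t s : odd (lv t) = b -> ~ win b G t -> child t s -> ~ win b G s.
Proof. by move=> ot nw c ws; apply: nw; exact: win_own c ws. Qed.
Lemma nwin_opp b G t : odd (lv t) = ~~ b -> ~ win b G t -> exists s, child t s /\ ~ win b G s.
Proof.
move=> ot nw; apply: contrapT => H; apply: nw; apply: win_opp => // s c.
by apply: contrapT => nws; apply: H; exists s.
Qed.

(** Gale-Stewart: outside [win] the opponent of [b] can always move to another such node, and [b]
    has no move that leaves this set. *)
Lemma open_game b G : (exists f, strat f /\ forall x, branch x -> follows b f x -> exists n, G (x n)) \/
  (exists f, strat f /\ forall x, branch x -> follows (~~ b) f x -> forall n, ~ G (x n)).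
Proof.
case: (pselect (win b G (root T))) => [w|nw].
  left; have [f [sf rf]] := win_reaches w; exists f; split=> // x bx fx.
  have [||n [_ Gn]] := rf x bx.
  - by apply: root_uniq; rewrite bx.1 lv_root.
  - by move=> n _; exact: fx.
  - by exists n.
right.
exists (fun t => match pselect (exists s, child t s /\ ~ win b G s) with left e => sval (cid e) | _ => dchild t end).
split=> [t|x bx fx].
  by case: pselect => /= [e|_]; [case: cid => s [] | exact: dchildP].
suff H n : ~ win b G (x n) by move=> n Gn; apply: (H n); exact: win_base.
elim: n => [|n IH]; first by rewrite (root_uniq (bx.1 0)).
case: (boolP (odd n == b)) => [/eqP on|]; first by apply: nwin_own IH (branch_child n bx); rewrite bx.1.
rewrite -eqbF_neg => /eqP ne; have {ne} on : odd n = ~~ b by move: ne; clear; case: (odd n); case: b.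
rewrite fx //; case: pselect => /= [e|[]]; first by case: cid => s [].
by apply: nwin_opp => //; rewrite bx.1.
Qed.

Definition is_first G l t u :=
  [/\ l <= lv u <= lv t, anc (lv u) t = u, G u & forall m, l <= m < lv u -> ~ G (anc m t)].
Definition first G l t : option T :=
  match pselect (exists u, is_first G l t u) with left e => Some (sval (cid e)) | _ => None end.

Lemma first_some x G l N n : branch x -> l <= N <= n -> G (x N) ->
  (forall m, l <= m < N -> ~ G (x m)) -> first G l (x n) = Some (x N).
Proof.
move=> bx /andP[lN Nn] GN Nmin; rewrite /first; case: pselect => /= [e|[]].
  case: cid => u [] /andP[lu ut] au Gu Hu /=; congr Some.
  rewrite bx.1 in ut; rewrite anc_branch // in au.
  suff -> : N = lv u by [].
  case: (ltngtP N (lv u)) => // c.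
    by case: (Hu N); rewrite ?lN // anc_branch //; lia.
  by case: (Nmin (lv u)); rewrite ?lu ?au.
exists (x N); split; rewrite ?bx.1 ?lN ?anc_branch // => m /andP[lm mN].
rewrite anc_branch //; [by apply: Nmin; rewrite lm | lia].
Qed.

Lemma first_none x G l n : branch x -> (forall m, l <= m <= n -> ~ G (x m)) ->
  first G l (x n) = None.
Proof.
move=> bx H; rewrite /first; case: pselect => // e; exfalso; move: e => [u [] /andP[lu ut] au Gu _].
rewrite bx.1 in ut; case: (H (lv u)); rewrite ?lu //.
by rewrite -(anc_branch bx ut) au.
Qed.

(* Below level [l]: once the play has met [G], switch to [m1] with the first node
   of [G] met; otherwise, once it has met a node from which player [b] can force
   [G], force it; otherwise follow [m3]. *)
Definition chase b G l (m1 : T -> T -> T) (m3 : T -> T) t : T :=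
  match first G l t with
  | Some u => m1 u t
  | None => match first (win b G) l t with Some r => wstrat b G r t | None => m3 t end
  end.

Lemma chase_ext b G l m1 m1' m3 m3' t : (forall u, m1 u t = m1' u t) -> m3 t = m3' t ->
  chase b G l m1 m3 t = chase b G l m1' m3' t.
Proof. by rewrite /chase => H1 H3; case: first => //; case: first. Qed.

Lemma chase_child b G l m1 m3 t : (forall u, child t (m1 u t)) -> child t (m3 t) ->
  child t (chase b G l m1 m3 t).
Proof. by rewrite /chase => H1 H3; case: first => //; case: first => // r; exact: wstrat_strat. Qed.

Lemma ex_least (Q : nat -> Prop) l : (exists n, l <= n /\ Q n) ->
  exists N, [/\ l <= N, Q N & forall m, l <= m < N -> ~ Q m].
Proof.
move=> [n [ln Qn]].
have ex : exists n, `[< l <= n /\ Q n >] by exists n; apply/asboolP.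
have [N /asboolP[lN QN] Nmin] := find_ex_minn ex.
exists N; split=> // m /andP[lm mN] Qm.
have := Nmin m; move=> /(_ (asboolT (conj lm Qm))); lia.
Qed.

(** The middle phase cannot last: once a node of [win b G] is met, the forcing strategy reaches [G].
    Two outcomes remain. *)
Lemma chaseP b G l m1 m3 x : branch x ->
  (forall n, l <= n -> odd n = b -> x n.+1 = chase b G l m1 m3 (x n)) ->
  (exists N, [/\ l <= N, G (x N), (forall m, l <= m < N -> ~ G (x m)) &
     forall n, N <= n -> odd n = b -> x n.+1 = m1 (x N) (x n)]) \/
  ((forall n, l <= n -> ~ win b G (x n)) /\
   (forall n, l <= n -> odd n = b -> x n.+1 = m3 (x n))).
Proof.
move=> bx H; case: (pselect (exists n, l <= n /\ G (x n))) => [/ex_least[N [lN GN Nmin]]|nG].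
  left; exists N; split=> // n Nn on; rewrite H //; last lia.
  by rewrite /chase (first_some bx _ GN) // lN.
have nG' n : l <= n -> ~ G (x n) by move=> ln Gn; apply: nG; exists n.
case: (pselect (exists n, l <= n /\ win b G (x n))) => [/ex_least[N [lN wN Nmin]]|nw].
  have [|n Nn on|n [Nn Gn]] := wstratP wN bx.
  - by rewrite bx.1.
  - rewrite bx.1 in Nn; rewrite H //; last lia.
    rewrite /chase (first_none bx); last by move=> m /andP[lm _]; exact: nG'.
    by rewrite (first_some bx _ wN Nmin) // lN.
  - by rewrite bx.1 in Nn; case: (nG' n) => //; lia.
have nw' n : l <= n -> ~ win b G (x n) by move=> ln wn; apply: nw; exists n.
right; split=> // n ln on; rewrite H // /chase !(first_none bx) // => m /andP[lm _]; auto.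
Qed.

End Tree.

(** * Coverings and their inverse limits *)

Definition treemap (T' T : tree) (p : T' -> T) :=
  (forall t, lv (p t) = lv t) /\ (forall t, p (par t) = par (p t)).

(* [phi] transfers strategies of player [b] from [T'] to [T]; continuity
   ([lift_cont]) is what makes inverse limits of coverings work. *)
Record lifting (K : nat) (T' T : tree) (p : T' -> T) (b : bool)
    (phi : (T' -> T') -> T -> T) : Prop := Lifting {
  lift_strat : forall f, strat f -> strat (phi f);
  lift_cont : forall f g t, (forall t', lv t' <= lv t -> f t' = g t') -> phi f t = phi g t;
  lift_loc : forall f t', strat f -> lv t' < K -> phi f (p t') = p (f t');
  lift_branch : forall f x, strat f -> branch x -> follows b (phi f) x ->
    exists x', [/\ branch x', follows b f x' & forall n, p (x' n) = x n] }.

(** Martin's [K]-coverings: the two trees coincide up to level [K], which lets a sequence of them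
    with growing [K] have a limit. *)
Record covering (K : nat) (T' T : tree) (p : T' -> T) : Prop := Covering {
  cov_map : treemap p;
  cov_inj : forall s t, lv s <= K -> p s = p t -> s = t;
  cov_surj : forall t, lv t <= K -> exists t', p t' = t;
  cov_lift : forall b, exists phi, lifting K p b phi }.

Lemma treemap_branch (T' T : tree) (p : T' -> T) x :
  treemap p -> branch x -> branch (p \o x).
Proof. by move=> [pl pp] [limpt xp]; split=> n /=; rewrite ?pl ?limpt // -pp xp. Qed.

Lemma treemap_child (T' T : tree) (p : T' -> T) t s :
  treemap p -> child t s -> child (p t) (p s).
Proof. by move=> [pl pp] [e l]; split; rewrite -?pp ?e // !pl. Qed.

Lemma treemap_comp (T1 T2 T3 : tree) (p : T1 -> T2) (q : T2 -> T3) :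
  treemap p -> treemap q -> treemap (q \o p).
Proof. by move=> [pl pp] [ql qp]; split=> t /=; rewrite ?ql ?pl // pp qp. Qed.

Lemma covering_comp K (T1 T2 T3 : tree) (p : T1 -> T2) (q : T2 -> T3) :
  covering K p -> covering K q -> covering K (q \o p).
Proof.
move=> [pm pi ps pl] [qm qi qs ql]; split.
- exact: treemap_comp.
- by move=> s t ls /= e; apply: pi => //; apply: qi => //; rewrite pm.1.
- move=> t lt; have [t2 e2] := qs t lt.
  have [|t1 e1] := ps t2; first by rewrite -qm.1 e2.
  by exists t1; rewrite /= e1.
- move=> b; have [f [fs fc fl fb]] := pl b; have [g [gs gc gl gb]] := ql b.
  exists (g \o f); split=> /=.
  + by move=> h sh; apply/gs/fs.
  + by move=> h h' t H; apply: gc => t' lt'; apply: fc => t'' lt''; apply: H; lia.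
  + by move=> h t sh lt; rewrite gl ?fl ?pm.1 //; exact: fs.
  + move=> h x sh bx fx; have [y [By fy ey]] := gb _ x (fs _ sh) bx fx.
    have [z [bz fz ez]] := fb _ y sh By fy.
    by exists z; split=> // n; rewrite ez.
Qed.

Lemma covering_le K K' (T' T : tree) (p : T' -> T) : K' <= K -> covering K p -> covering K' p.
Proof.
move=> KK [pm pi ps pl]; split=> //.
- by move=> s t ls; apply: pi; lia.
- by move=> t lt; apply: ps; lia.
- move=> b; have [f [fs fc fl fb]] := pl b; exists f; split=> //.
  by move=> g t sg lt; apply: fl => //; lia.
Qed.

Section Limit.
Variables (K : nat) (F : nat -> tree) (p : forall i, F i.+1 -> F i).
Hypothesis pcov : forall i, covering (K + i) (@p i).

Definition thread := {t : forall i, F i | forall i, p (t i.+1) = t i}.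
Definition thr (t : thread) i : F i := sval t i.

Lemma thread_eq (s t : thread) : (forall i, thr s i = thr t i) -> s = t.
Proof.
case: s t => s Hs [t Ht] H; apply: eq_exist.
exact: functional_extensionality_dep.
Qed.

Lemma thrE (t : thread) i : p (thr t i.+1) = thr t i.
Proof. exact: (svalP t). Qed.

Lemma lv_thr (t : thread) i : lv (thr t i) = lv (thr t 0).
Proof. by elim: i => // i IH; rewrite -IH -(thrE t i) (cov_map (pcov i)).1. Qed.

Lemma par_thread_subproof (t : thread) i : p (par (thr t i.+1)) = par (thr t i).
Proof. by rewrite (cov_map (pcov i)).2 thrE. Qed.
Definition par_thread (t : thread) : thread := exist _ (fun i => par (thr t i)) (par_thread_subproof t).

Lemma root_thread_subproof i : p (root (F i.+1)) = root (F i).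
Proof. by apply: root_uniq; rewrite (cov_map (pcov i)).1 lv_root. Qed.
Definition root_thread : thread := exist _ (fun i => root (F i)) root_thread_subproof.

Lemma thread_inj (s t : thread) i : lv (thr s 0) <= K + i -> thr s i = thr t i -> s = t.
Proof.
move=> ls e; apply: thread_eq => j.
case: (leqP j i) => [ji|].
  elim: i ji e {ls} => [|i IH] ji e; first by have -> : j = 0 by lia.
  case: (eqVneq j i.+1) => [->//|ne]; apply: IH; first lia.
  by rewrite -(thrE s i) -(thrE t i) e.
elim: j => // j IH ij; apply: (cov_inj (pcov j)); first by rewrite lv_thr; lia.
rewrite !thrE; case: (ltnP i j) => [/IH//|ji].
by have -> : j = i by lia.
Qed.
End Limit.

Lemma thread_ex0 K (F : nat -> tree) (p : forall i, F i.+1 -> F i) :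
  (forall i, covering (K + i) (@p i)) ->
  forall s : F 0, lv s <= K -> exists t : thread p, thr t 0 = s.
Proof.
move=> pcov s ls.
have step i (u : {u : F i | lv u <= K}) : {v : {v : F i.+1 | lv v <= K} | p i (sval v) = sval u}.
  case: u => u lu /=; apply: cid.
  have [|v e] := cov_surj (pcov i) (t := u); first lia.
  have lv' : lv v <= K by rewrite -(cov_map (pcov i)).1 e.
  by exists (exist _ v lv').
pose t := nat_rect (fun i => {u : F i | lv u <= K}) (exist _ s ls) (fun i u => sval (step i u)).
have Ht i : p i (sval (t i.+1)) = sval (t i) by exact: (svalP (step i (t i))).
by exists (exist _ (fun i => sval (t i)) Ht).
Qed.

Lemma thread_ex K (F : nat -> tree) (p : forall i, F i.+1 -> F i) :
  (forall i, covering (K + i) (@p i)) ->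
  forall i (s : F i), lv s <= K + i -> exists t : thread p, thr t i = s.
Proof.
move=> pcov i; elim: i K F p pcov => [|i IH] K F p pcov s ls.
  by apply: (thread_ex0 pcov); rewrite addn0 in ls.
(* Dropping [F 0] leaves a system for [K.+1]; hence the induction generalises [K], [F] and [p]. *)
have pcov' j : covering (K.+1 + j) (@p j.+1) by rewrite addSnnS.
have [|t et] := IH K.+1 (fun i => F i.+1) (fun i => @p i.+1) pcov' s; first lia.
pose u j : F j := match j with 0 => p 0 (thr t 0) | j'.+1 => thr t j' end.
have Hu j : p j (u j.+1) = u j by case: j => [|j] //=; exact: thrE.
by exists (exist _ u Hu).
Qed.

Section Limit2.
Variables (K : nat) (F : nat -> tree) (p : forall i, F i.+1 -> F i).
Hypothesis pcov : forall i, covering (K + i) (@p i).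

Lemma thread_child (t : thread p) : exists s : thread p,
  par_thread pcov s = t /\ lv (thr s 0) = (lv (thr t 0)).+1.
Proof.
pose i := (lv (thr t 0)).+1.
have [c [pc lc]] := child_ex (thr t i).
rewrite (lv_thr pcov) // in lc.
have [|s es] := thread_ex pcov (s := c); first by rewrite lc -/i; lia.
have ls : lv (thr s 0) = (lv (thr t 0)).+1 by rewrite -(lv_thr pcov s i) es.
exists s; split=> //.
apply: (thread_inj pcov (i := i)); rewrite /thr /= -/(thr s _).
  by rewrite lv_par ls /= /i; lia.
by rewrite es.
Qed.

Lemma thread_root (t : thread p) : lv (thr t 0) = 0 -> t = root_thread pcov.
Proof. by move=> l0; apply: thread_eq => i; apply: root_uniq; rewrite (lv_thr pcov). Qed.

Definition limit_tree : tree :=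
  @Tree (thread p) (fun t => lv (thr t 0)) (par_thread pcov) (root_thread pcov)
   (lv_root (F 0)) thread_root (fun t => lv_par (thr t 0)) thread_child.

Definition lim_proj i (t : limit_tree) : F i := thr t i.

Lemma lim_proj_map i : treemap (@lim_proj i).
Proof. by split=> t //; rewrite /lim_proj (lv_thr pcov). Qed.

Section LimitLift.
Variables (b : bool) (phi : forall i, (F i.+1 -> F i.+1) -> F i -> F i).
Hypothesis phiP : forall i, lifting (K + i) (@p i) b (@phi i).
Variable f : limit_tree -> limit_tree.

(* The strategy of [F i] induced by [f] below level [K + i], where [F i] and the
   limit tree agree. *)
Definition tau i (s : F i) : F i :=
  match pselect (lv s < K + i) with
  | left l => thr (f (sval (cid (thread_ex pcov (ltnW l))))) i
  | right _ => dchild s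
  end.

Lemma tauE i (t : limit_tree) : lv t < K + i -> tau (thr t i) = thr (f t) i.
Proof.
move=> lt; rewrite /tau; case: pselect => [l|]; last by rewrite (lv_thr pcov).
congr (thr (f _) i); case: cid => u eu /=.
by apply: (thread_inj pcov (i := i)) => //; rewrite -(lv_thr pcov u i) eu (lv_thr pcov) //; exact: ltnW.
Qed.

Hypothesis sf : strat f.

Lemma tau_strat i : strat (@tau i).
Proof.
move=> s; rewrite /tau; case: pselect => [l|_]; last exact: dchildP.
case: cid => u /= <-.
exact: (treemap_child (lim_proj_map i) (sf u)).
Qed.

(* [tau (i + d)] pushed down to [F i]; by continuity it stabilises as [d] grows,
   and [sigma i] is the limit. *)
Fixpoint rho d i : F i -> F i :=
  if d is d'.+1 then phi (@rho d' i.+1) else @tau i.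

Lemma rho_strat d i : strat (@rho d i).
Proof. by elim: d i => [|d IH] i; [exact: tau_strat|exact: (lift_strat (phiP i) (IH _))]. Qed.

(** At depth 0 this is [lift_loc], as [tau] acts like [f] on both trees; continuity carries it to
    greater depth. *)
Lemma rhoS d i s : lv s < K + i + d -> @rho d.+1 i s = @rho d i s.
Proof.
elim: d i s => [|d IH] i s ls.
  rewrite /=; have [|t et] := thread_ex pcov (s := s); first lia.
  have lt : lv (t : limit_tree) = lv s by rewrite -et (lv_thr pcov).
  rewrite -et tauE; last by rewrite lt; lia.
  rewrite -[in LHS](thrE t i) (lift_loc (phiP i)); last first.
  - by rewrite (lv_thr pcov) //; rewrite /= in lt; rewrite lt; lia.
  - exact: tau_strat.
  by rewrite tauE ?thrE // lt; lia.
rewrite [LHS]/= [RHS]/=; apply: (lift_cont (phiP i)) => t' lt'.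
by rewrite -IH //; lia.
Qed.

Lemma rho_stable d i s : lv s < K + i + d -> forall e, d <= e -> @rho e i s = @rho d i s.
Proof.
move=> ls; elim=> [|e IH] de; first by have -> : d = 0 by lia.
case: (eqVneq d e.+1) => [->//|ne].
rewrite rhoS; [apply: IH; lia | lia].
Qed.

Definition sigma i (s : F i) : F i := @rho (lv s).+1 i s.

Lemma sigmaE d i s : lv s < K + i + d -> @sigma i s = @rho d i s.
Proof.
move=> l; rewrite /sigma; case: (leqP d (lv s).+1) => h.
  by rewrite (rho_stable l).
by rewrite [RHS](rho_stable (d := (lv s).+1)) //; lia.
Qed.

Lemma sigma_strat i : strat (@sigma i).
Proof. by move=> s; exact: rho_strat. Qed.

(** Coherence of the limits: a branch following [sigma i] lifts to one following [sigma i.+1], and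
    so on through the whole system. *)
Lemma sigma_phi i : @sigma i = phi (@sigma i.+1).
Proof.
apply/funext => s; rewrite (@sigmaE (lv s).+2) /=; last lia.
by apply: (lift_cont (phiP i)) => t' lt'; rewrite (@sigmaE (lv s).+1) //; lia.
Qed.

Lemma sigma_loc i (t : limit_tree) : lv t < K + i -> sigma (thr t i) = thr (f t) i.
Proof.
move=> lt; rewrite (@sigmaE 0); first exact: tauE.
by rewrite (lv_thr pcov) addn0.
Qed.

Lemma limit_lift_branch (x : nat -> F 0) : branch x -> follows b (@sigma 0) x ->
  exists x' : nat -> limit_tree, [/\ branch x', follows b f x' & forall n, thr (x' n) 0 = x n].
Proof.
move=> bx fx.
have step i (y : {y : nat -> F i | branch y /\ follows b (@sigma i) y}) :
  {z : {z : nat -> F i.+1 | branch z /\ follows b (@sigma i.+1) z} |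
     forall n, p (sval z n) = sval y n}.
  case: y => y /= [By fy]; apply: cid; rewrite sigma_phi in fy.
  have [z [bz fz ez]] := lift_branch (phiP i) (@sigma_strat _) By fy.
  by exists (exist _ z (conj bz fz)).
pose X := nat_rect (fun i => {y : nat -> F i | branch y /\ follows b (@sigma i) y})
  (exist _ x (conj bx fx)) (fun i u => sval (step i u)).
have HX n i : p (sval (X i.+1) n) = sval (X i) n by exact: (svalP (step i (X i))).
have bX i := (svalP (X i)).1; have fX i := (svalP (X i)).2.
pose x' n : limit_tree := exist _ (fun i => sval (X i) n) (HX n).
have bx' : branch x'.
  split=> n; first exact: (bx.1 n).
  by apply: thread_eq => i; exact: ((bX i).2 n).
exists x'; split=> // n on.
(* Nodes of level [n.+1] may be compared at coordinate [n.+1], where [sigma] already acts like [f]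
   on level [n]. *)
apply: (thread_inj pcov (i := n.+1)).
  by rewrite (_ : lv _ = n.+1); [lia | exact: (bx'.1 n.+1)].
rewrite -sigma_loc; first exact: (fX n.+1 n on).
rewrite bx'.1; lia.
Qed.
End LimitLift.

Lemma limit_covering : covering K (@lim_proj 0).
Proof.
split.
- exact: lim_proj_map.
- by move=> s t ls e; apply: (thread_inj pcov (i := 0)) => //; rewrite addn0.
- by move=> t lt; have [|s es] := thread_ex pcov (s := t); [rewrite addn0|exists s].
- move=> b.
  pose phi i := sval (cid (cov_lift (pcov i) b)).
  have phiP i : lifting (K + i) (@p i) b (phi i) by exact: (svalP (cid (cov_lift (pcov i) b))).
  exists (fun f => @sigma phi f 0); split.
  + by move=> f sf; exact: sigma_strat.
  + move=> f g t H.
    have Ht i s : lv s <= lv t -> tau f s = tau g s :> F i.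
      move=> ls; rewrite /tau; case: pselect => // l; congr (thr _ i); apply: H.
      by case: cid => u eu /=; rewrite -(lv_thr pcov u i) eu.
    have Hr d i s : lv s <= lv t -> rho phi f d s = rho phi g d s :> F i.
      elim: d i s => [|d IH] i s ls /=; first exact: Ht.
      by apply: (lift_cont (phiP i)) => t' lt'; apply: IH; lia.
    by rewrite /sigma Hr.
  + by move=> f t sf lt; rewrite /lim_proj (sigma_loc phiP) // addn0.
  + by move=> f x sf bx fx; exact: limit_lift_branch.
Qed.
End Limit2.

(** * Unravelling a closed set *)

Section Unravel.
Variables (T : tree) (X : (nat -> T) -> Prop) (L : nat).
Hypothesis Leven : odd L = false.
Hypothesis Xclosed : forall x, branch x -> ~ X x ->
  exists n, forall y, branch y -> y n = x n -> ~ X y.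

Implicit Types (s t u : T) (A B : set T) (c : T + set T).

Definition dead t := forall x, branch x -> x (lv t) = t -> ~ X x.

Lemma dead_mono x m n : branch x -> m <= n -> dead (x m) -> dead (x n).
Proof.
move=> bx mn dm y By e; apply: dm => //; rewrite bx.1; rewrite bx.1 in e.
exact: branch_agree e mn.
Qed.

Lemma dead_ex x l : branch x -> ~ X x -> exists n, l <= n /\ dead (x n).
Proof.
move=> bx nX; have [n Hn] := Xclosed bx nX; exists (maxn l n); split; first exact: leq_maxl.
apply: (dead_mono (m := n)) => //; first exact: leq_maxr.
by move=> y By; rewrite bx.1; exact: Hn.
Qed.

(** Multivalued strategies are announced because the nodes from which the opponent cannot force a
    target form one, as in [BI] and [NII]. *)
Definition qI A t1 := A t1 /\ forall s, A s ->
  if odd (lv s) then forall s', child s s' -> A s' else exists s', child s s' /\ A s'.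
Definition qII A B t2 := B t2 /\ forall s, B s -> [/\ A s, ~ dead s &
  if odd (lv s) then exists s', child s s' /\ B s' else forall s', child s s' -> A s' -> B s'].

Definition cmp t u := forall m, m <= lv t -> m <= lv u -> anc m t = anc m u.

(* Martin's auxiliary game at the even level [L]. With his move to level [L.+1]
   player I also announces a quasi-strategy [A] for himself. With his move to level
   [L.+2] player II either announces a node [u] of [A] outside the tree of [X],
   towards which both players must then play, or a quasi-strategy [B] for himself
   inside [A] and inside the tree of [X], in which both players must then stay.
   Unused components have the dummy values [set0] and [inr set0]. *)
Definition rawpos := (T * set T * (T + set T))%type.

Definition valid (z : rawpos) : Prop :=
  let: (t, A, c) := z in
  if lv t <= L then A = set0 /\ c = inr set0
  else if lv t == L.+1 then qI A t /\ c = inr set0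
  else qI A (anc L.+1 t) /\
    match c with
    | inl u => [/\ dead u, A u, L.+1 < lv u & cmp t u]
    | inr B => qII A B (anc L.+2 t) /\ forall m, L.+1 < m <= lv t -> B (anc m t)
    end.

(** Dummies fill the levels where the announcements [A] and [c] have not yet been made; a run with
    fixed announcements is then just a branch of [T]. *)
Definition tri A c t : rawpos :=
  (t, if lv t <= L then set0 else A, if lv t <= L.+1 then inr set0 else c).

Lemma valid_low A c t : lv t <= L -> valid (tri A c t).
Proof. by move=> l; rewrite /valid /tri l (leq_trans l (leqnSn _)). Qed.

Lemma valid_mid A c t : lv t = L.+1 -> qI A t -> valid (tri A c t).
Proof. by move=> l q; rewrite /valid /tri l ltnn eqxx leqnn. Qed.

Lemma valid_high A c t : L.+1 < lv t -> valid (tri A c t) <-> (qI A (anc L.+1 t) /\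
    match c with
    | inl u => [/\ dead u, A u, L.+1 < lv u & cmp t u]
    | inr B => qII A B (anc L.+2 t) /\ forall m, L.+1 < m <= lv t -> B (anc m t)
    end).
Proof.
move=> l; rewrite /valid /tri; have -> : (lv t <= L) = false by lia.
have -> : (lv t <= L.+1) = false by lia.
by have -> : (lv t == L.+1) = false by lia.
Qed.

Lemma tri_id t A c : valid (t, A, c) -> tri A c t = (t, A, c).
Proof.
rewrite /valid /tri; case: (leqP (lv t) L) => [l [-> ->]|l].
  by rewrite (leq_trans l (leqnSn _)).
case: eqP => [-> [_ ->]|ne _]; first by rewrite leqnn.
by have -> : (lv t <= L.+1) = false by lia.
Qed.

Lemma valid_par A c t : valid (tri A c t) -> valid (tri A c (par t)).
Proof.
case: (leqP (lv (par t)) L) => [l _|l]; first exact: valid_low.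
have lt : lv (par t) = (lv t).-1 := lv_par t.
have ct : child (par t) t by split=> //; lia.
rewrite valid_high; last lia.
move=> [q h]; case: (eqVneq (lv (par t)) L.+1) => [e|ne].
  have E : anc L.+1 t = par t by rewrite -e (anc_child ct) // anc_id.
  by apply: valid_mid => //; rewrite -E.
rewrite valid_high; last lia.
rewrite -(anc_child ct) //; split=> //.
rewrite -(anc_child ct); last lia.
case: c h => [u [d au lu cm]|B [qb Bm]].
  split=> // m m1 m2; rewrite -(anc_child ct) //; apply: cm => //; lia.
split=> // m m1; rewrite -(anc_child ct); last lia.
by apply: Bm; lia.
Qed.

Definition ucar := {z : rawpos | valid z}.
Definition pos (y : ucar) : T := (sval y).1.1.
Definition posA (y : ucar) : set T := (sval y).1.2.
Definition posc (y : ucar) : T + set T := (sval y).2.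

Lemma ucar_tri (y : ucar) : sval y = tri (posA y) (posc y) (pos y).
Proof. by case: y => [[[t A] c] v]; rewrite /posA /posc /pos /= tri_id. Qed.

Lemma ucar_valid (y : ucar) : valid (tri (posA y) (posc y) (pos y)).
Proof. by rewrite -ucar_tri; exact: (svalP y). Qed.

Definition upar (y : ucar) : ucar :=
  exist _ (tri (posA y) (posc y) (par (pos y))) (valid_par (ucar_valid y)).

Lemma lv_root_L : lv (root T) <= L. Proof. by rewrite lv_root. Qed.
Definition uroot : ucar := exist _ (tri set0 (inr set0) (root T)) (valid_low set0 (inr set0) lv_root_L).

Definition mk (z : rawpos) : ucar :=
  match pselect (valid z) with left v => exist _ z v | right _ => uroot end.

Lemma sval_mk z : valid z -> sval (mk z) = z.
Proof. by rewrite /mk; case: pselect. Qed.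

Lemma ucar_inj (y y' : ucar) : sval y = sval y' -> y = y'.
Proof. by case: y y' => z v [z' v'] /= e; apply: eq_exist. Qed.

Lemma mkK (y : ucar) : mk (sval y) = y.
Proof. by apply: ucar_inj; rewrite sval_mk //; exact: (svalP y). Qed.

Lemma tri_low A c A' c' t : lv t <= L -> tri A c t = tri A' c' t.
Proof. by move=> l; rewrite /tri l (leq_trans l (leqnSn _)). Qed.

Lemma tri_tri A c t s : lv s <= lv t ->
  tri (tri A c t).1.2 (tri A c t).2 s = tri A c s.
Proof.
move=> st; rewrite /tri /=.
case: (leqP (lv s) L) => l1; case: (leqP (lv s) L.+1) => l2 //; try lia.
  by have -> : (lv t <= L) = false by lia.
have -> : (lv t <= L) = false by lia.
by have -> : (lv t <= L.+1) = false by lia.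
Qed.

Lemma upar_mk A c t : valid (tri A c t) -> sval (upar (mk (tri A c t))) = tri A c (par t).
Proof.
move=> v; rewrite /upar /= /posA /posc /pos !sval_mk //= -[RHS](@tri_tri _ _ t) //.
by rewrite lv_par; lia.
Qed.

Lemma uchild_ex (y : ucar) : exists y', upar y' = y /\ lv (pos y') = (lv (pos y)).+1.
Proof.
have sfc A c s : valid (tri A c s) -> child (pos y) s -> tri A c (pos y) = sval y ->
    exists y', upar y' = y /\ lv (pos y') = (lv (pos y)).+1.
  move=> v [ps ls] e; exists (mk (tri A c s)); split.
    by apply: ucar_inj; rewrite upar_mk // ps.
  by rewrite /pos sval_mk.
set t := pos y in sfc *.
have yv := ucar_valid y; have ye := ucar_tri y; rewrite -/t in yv ye.
set A := posA y in yv ye; set c := posc y in yv ye.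
case: (ltngtP (lv t) L) => l.
- apply: (sfc set0 (inr set0) (dchild t)); last by rewrite ye; exact/tri_low/ltnW.
    by apply: valid_low; rewrite (dchildP _).2.
  exact: dchildP.
- case: (ltngtP (lv t) L.+1) => l1; first lia.
    move: yv; rewrite valid_high // => -[q]; case: c ye => [u ye [d au lu cm]|B ye [[Bt2 qb] Bm]].
      pose s := if lv t < lv u then anc (lv t).+1 u else dchild t.
      have cs : child t s.
        rewrite /s; case: (ltnP (lv t) (lv u)) => h; last exact: dchildP.
        split; last by rewrite lv_anc.
        rewrite -[RHS](anc_id t) cm //; last exact: ltnW.
        by rewrite /anc (_ : lv u - lv t = (lv u - (lv t).+1).+1) //; lia.
      apply: (sfc A (inl u) s) => //; rewrite valid_high; last by rewrite cs.2; lia.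
      rewrite (anc_child cs); last lia.
      split=> //; split=> // m m1 m2.
      case: (eqVneq m (lv s)) => [em|ne]; last first.
        rewrite (anc_child cs); first by apply: cm => //; rewrite cs.2 in m1 ne; lia.
        by rewrite cs.2 in m1 ne; lia.
      rewrite em cs.2 in m2.
      by rewrite em anc_id cs.2 /s m2.
    have Bt : B t by rewrite -(anc_id t); apply: Bm; lia.
    have [At nd h] := qb _ Bt.
    have [s [cs Bs]] : exists s, child t s /\ B s.
      case: (odd (lv t)) (q.2 _ At) h => [_ //|[s [cs As]] H].
      by exists s; split=> //; exact: H.
    apply: (sfc A (inr B) s) => //; rewrite valid_high; last by rewrite cs.2; lia.
    rewrite !(anc_child cs); [|lia|lia].
    split=> //; split=> // m m1; case: (eqVneq m (lv s)) => [->|ne]; first by rewrite anc_id.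
    rewrite cs.2 in m1 ne; rewrite (anc_child cs); last lia.
    by apply: Bm; lia.
  have q : qI A t by move: yv; rewrite /valid /tri l1 ltnn eqxx => -[].
  have At := q.1.
  have {}q1 := q.2 _ At; rewrite l1 /= Leven /= in q1.
  pose s := dchild t; have cs : child t s := dchildP t.
  have As := q1 _ cs.
  have eA c' : tri A c' t = sval y.
    by rewrite ye /tri l1 leqnn.
  have an1 : anc L.+1 s = t by rewrite (anc_child cs) -?l1 // anc_id.
  have an2 : anc L.+2 s = s by rewrite -l1 -cs.2 anc_id.
  (* If no dead node of [A] can be announced at [s], then all of [A] beyond [s] is a legal
     quasi-strategy for II. *)
  case: (pselect (exists u, [/\ dead u, A u, L.+1 < lv u & cmp s u])) => [[u H]|nd].
    apply: (sfc A (inl u) s) => //; rewrite valid_high; last by rewrite cs.2 l1.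
    by rewrite an1.
  pose B := [set v | A v /\ L.+1 < lv v /\ anc L.+2 v = s].
  have Bs : B s by split=> //; split; [rewrite cs.2 l1|].
  apply: (sfc A (inr B) s) => //; rewrite valid_high; last by rewrite cs.2 l1.
  rewrite an1 an2; split=> //; split.
    split=> // v [Av [lv' av]].
    have Bch v' : child v v' -> A v' -> B v'.
      by move=> cv Av'; split=> //; rewrite cv.2 (anc_child cv) //; split=> //; lia.
    split=> //.
      move=> dv; apply: nd; exists v; split=> // m m1 m2.
      rewrite cs.2 l1 in m1; by rewrite -av anc_anc.
    have := q.2 _ Av; case: (odd (lv v)) => H; last exact: Bch.
    exists (dchild v); split; first exact: dchildP.
    by apply: Bch; [exact: dchildP | apply: H; exact: dchildP].
  move=> m; rewrite cs.2 l1 => m1; have -> : m = L.+2 by lia.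
  by rewrite an2.
- pose s := dchild t; have cs : child t s := dchildP t.
  apply: (sfc setT (inr set0) s) => //; last by rewrite ye; apply: tri_low; rewrite l.
  apply: valid_mid; first by rewrite cs.2 l.
  split=> // v _; case: odd => //; exists (dchild v); split=> //; exact: dchildP.
Qed.

Lemma uroot_uniq (y : ucar) : lv (pos y) = 0 -> y = uroot.
Proof.
move=> l0; apply: ucar_inj; rewrite ucar_tri (root_uniq l0) /=; apply: tri_low.
exact: lv_root_L.
Qed.

Definition utree : tree :=
  @Tree ucar (fun y => lv (pos y)) upar uroot (lv_root T) uroot_uniq
    (fun y => lv_par (pos y)) uchild_ex.

Lemma pos_map : @treemap utree T pos.
Proof. by []. Qed.

Lemma pos_mk A c t : valid (tri A c t) -> pos (mk (tri A c t)) = t.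
Proof. by move=> v; rewrite /pos sval_mk. Qed.

Lemma lv_mk A c t : lv (mk (tri A c t) : utree) <= lv t.
Proof. by rewrite /= /mk; case: pselect => v //=; rewrite /pos /= lv_root. Qed.

Lemma uchild_data A c t (y : utree) : valid (tri A c t) ->
  child (mk (tri A c t) : utree) y ->
  [/\ child t (pos y), L < lv t -> posA y = A & L.+1 < lv t -> posc y = c].
Proof.
move=> v [e l].
have ct : child t (pos y).
  by have := treemap_child pos_map (conj e l : child _ y); rewrite pos_mk.
have := congr1 sval e; rewrite sval_mk //= ct.1 => -[]; split=> //.
  by move=> lt; have h : (lv t <= L) = false by [lia]; move: H; rewrite h.
by move=> lt; have h : (lv t <= L.+1) = false by [lia]; move: H0; rewrite h.
Qed.

Lemma uchild_eq A c t (y : utree) t' : valid (tri A c t) ->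
  child (mk (tri A c t) : utree) y -> pos y = t' ->
  (lv t = L -> posA y = A) -> (lv t = L.+1 -> posc y = c) -> y = mk (tri A c t').
Proof.
move=> v cy e HA Hc; have [ct hA hc] := uchild_data v cy.
rewrite -[LHS]mkK ucar_tri e; congr mk; have := ct.2; rewrite e /tri => ->.
congr (_, _, _).
  case: (ltngtP (lv t) L) => h //; [exact: hA | exact: HA].
rewrite ltnS; case: (leqP (lv t) L) => h //.
by case: (eqVneq (lv t) L.+1) => h'; [exact: Hc | apply: hc; lia].
Qed.

Lemma run_branch A c (x : nat -> T) : branch x -> (forall n, valid (tri A c (x n))) ->
  @branch utree (fun n => mk (tri A c (x n))).
Proof.
move=> bx v; split=> n /=; first by rewrite pos_mk // bx.1.
by apply: ucar_inj; rewrite upar_mk // sval_mk // bx.2.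
Qed.

Section LiftI.

(* Where I cannot force leaving the tree of [X] inside [A], II has a
   quasi-strategy for staying in it. *)
Definition BI A : set T := [set s | A s /\ ~ win false [set u | A u /\ dead u] s].
Definition phiI (f : utree -> utree) t : T :=
  if lv t <= L then pos (f (mk (tri set0 (inr set0) t))) else
  let A := posA (f (mk (tri set0 (inr set0) (anc L t)))) in
  chase false [set u | A u /\ dead u] L.+2
    (fun u t => fixc t (pos (f (mk (tri A (inl u) t)))))
    (fun t => fixc t (pos (f (mk (tri A (inr (BI A)) t))))) t.

Lemma pos_strat_low (f : utree -> utree) t : strat f -> lv t <= L ->
  child t (pos (f (mk (tri set0 (inr set0) t)))).
Proof.
move=> sf l; have v := valid_low set0 (inr set0) l.
by have [] := uchild_data v (sf (mk (tri set0 (inr set0) t))).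
Qed.

(** I pretends that II announced [BI A]. If a node is met from which a dead node of [A] can be
    forced, I forces one, and the run is reinterpreted as if II had announced it at once; the rules
    steer towards that node, so the earlier moves agree with [f] all the same. *)
Lemma lift_I : lifting L (pos : utree -> T) false phiI.
Proof.
split.
- move=> f sf t; rewrite /phiI; case: leqP => l; first exact: pos_strat_low.
  by apply: chase_child => [u|]; exact: fixcP.
- move=> f g t H; rewrite /phiI; case: leqP => l.
    by rewrite H //; exact: lv_mk.
  rewrite (H (mk (tri set0 _ _))); last first.
    apply: leq_trans (lv_mk _ _ _) _; rewrite lv_anc; lia.
  by apply: chase_ext => [u|]; rewrite H //; exact: lv_mk.
- move=> f y sf l; rewrite /phiI ifT; last exact: ltnW.
  congr (pos (f _)); rewrite -[RHS]mkK ucar_tri; congr mk; apply: tri_low; exact: ltnW.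
- move=> f x sf bx fx.
  pose A := posA (f (mk (tri set0 (inr set0) (x L)))).
  have fxlow n : odd n = false -> n <= L -> x n.+1 = pos (f (mk (tri set0 (inr set0) (x n)))).
    by move=> on nL; rewrite fx // /phiI bx.1 nL.
  have qA : qI A (x L.+1).
    have := ucar_valid (f (mk (tri set0 (inr set0) (x L)))).
    rewrite -fxlow // -/A /valid /tri bx.1 ltnn eqxx; by case.
  have At2 : A (x L.+2).
    have := qA.2 _ qA.1; rewrite bx.1 /= Leven => /(_ (x L.+2)); apply; exact: branch_child.
  set G := [set u | A u /\ dead u].
  have vlow c n : n < L.+2 -> valid (tri A c (x n)).
    move=> n2; case: (leqP n L) => h; first by apply: valid_low; rewrite bx.1.
    have -> : n = L.+1 by lia.
    by apply: valid_mid => //; rewrite bx.1.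
  have fol c n : odd n = false -> valid (tri A c (x n)) ->
     (n <= L \/ x n.+1 = pos (f (mk (tri A c (x n))))) -> mk (tri A c (x n.+1)) = f (mk (tri A c (x n))).
    move=> on v h; have e : x n.+1 = pos (f (mk (tri A c (x n)))).
      case: h => // h; rewrite fxlow //; congr (pos (f (mk _))); apply: tri_low; by rewrite bx.1.
    symmetry; apply: (@uchild_eq _ _ (x n)) => //; rewrite bx.1 => en.
      rewrite en (tri_low A c set0 (inr set0)) //; by rewrite bx.1.
    by move: on; rewrite en /= Leven.
  have H n : L.+2 <= n -> odd n = false -> x n.+1 = chase false G L.+2
    (fun u t => fixc t (pos (f (mk (tri A (inl u) t)))))
    (fun t => fixc t (pos (f (mk (tri A (inr (BI A)) t))))) (x n).
    move=> ln on; rewrite fx // /phiI bx.1 ifN; last lia.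
    by rewrite anc_branch //; lia.
  have [[N [lN [AN dN] Nmin HN]]|[nw Hn]] := chaseP bx H.
    have v n : valid (tri A (inl (x N)) (x n)).
      case: (ltnP n L.+2) => n2; first exact: vlow.
      rewrite valid_high ?bx.1 //; rewrite anc_branch //; last lia.
      split=> //; split=> // m; rewrite !bx.1 => m1 m2; by rewrite !anc_branch.
    exists (fun n => mk (tri A (inl (x N)) (x n))); split; first exact: run_branch.
    + move=> n on; apply: fol => //.
      case: (leqP n L) => nL; [by left|right].
      have nL2 : L.+1 < n by move: on; case: (eqVneq n L.+1) => [->|]; rewrite /= ?Leven //; lia.
      have [cy _ hc] := uchild_data (v n) (sf (mk (tri A (inl (x N)) (x n)))).
      case: (leqP N n) => Nn.
        by rewrite {1}HN // fixc_id.
      (* Before level [N] a legal answer of [f] must be compatible with the announced [x N], hence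
         is the move actually made. *)
      set y := f _ in cy hc *.
      have yv := ucar_valid y; have ly := cy.2; rewrite bx.1 in ly.
      move: yv; rewrite hc ?bx.1 // valid_high; last by rewrite ly; lia.
      move=> [_ [_ _ _ /(_ n.+1)]]; rewrite ly bx.1 => /(_ (leqnn _) Nn).
      by rewrite -{1}ly anc_id anc_branch.
    + by move=> n; rewrite pos_mk.
  have qB : qII A (BI A) (x L.+2).
    split=> [|s [As nws]]; first by split=> //; exact: nw.
    split=> //; first by move=> ds; apply: nws; exact: win_base.
    have := qA.2 _ As; case: ifP => os hs.
      have [s' [c' nw']] := nwin_opp (b := false) os nws.
      by exists s'; split=> //; split=> //; exact: hs.
    by move=> s' c' As'; split=> //; exact: nwin_own c'.
  have vv n : L.+2 <= n -> (forall m, L.+1 < m <= n -> BI A (x m)) -> valid (tri A (inr (BI A)) (x n)).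
    move=> n2 Bm; rewrite valid_high ?bx.1 //; rewrite !anc_branch //; last lia.
    split=> //; split=> // m m1; rewrite anc_branch //; [exact: Bm | lia].
  have eqn n : L.+2 <= n -> odd n = false -> valid (tri A (inr (BI A)) (x n)) ->
     x n.+1 = pos (f (mk (tri A (inr (BI A)) (x n)))).
    move=> n2 on v; rewrite {1}Hn // fixc_id //.
    by have [] := uchild_data v (sf (mk (tri A (inr (BI A)) (x n)))).
  have Bx n : forall m, L.+1 < m <= n -> BI A (x m).
    elim: n => [|n IH] m mn; first lia.
    case: (eqVneq m n.+1) => [->|ne]; last by apply: IH; lia.
    have [->|Ln] : n = L.+1 \/ L.+2 <= n by lia.
      exact: qB.1.
    split; last by apply: nw; lia.
    have [An nwn] : BI A (x n) by apply: IH; lia.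
    have := qA.2 _ An; rewrite bx.1; case: (boolP (odd n)) => on; first by apply; exact: branch_child.
    have v := vv n Ln IH.
    have [cy hA hc] := uchild_data v (sf (mk (tri A (inr (BI A)) (x n)))).
    move=> _; rewrite eqn //; last exact: negbTE.
    set y := f _ in cy hA hc *; have := ucar_valid y; have ly := cy.2; rewrite bx.1 in ly.
    rewrite hA ?bx.1; last lia.
    rewrite hc ?bx.1 // valid_high; last by rewrite ly; lia.
    move=> [_ [_ /(_ n.+1)]]; rewrite ly leqnn => /(_ _)[]; first lia.
    by rewrite -{1}ly anc_id.
  have v n : valid (tri A (inr (BI A)) (x n)).
    by case: (ltnP n L.+2) => n2; [exact: vlow | apply: vv => //; exact: Bx].
  exists (fun n => mk (tri A (inr (BI A)) (x n))); split; first exact: run_branch.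
  + move=> n on; apply: fol => //.
    case: (leqP n L) => nL; [by left|right].
    apply: eqn => //; move: on; case: (eqVneq n L.+1) => [->|]; rewrite /= ?Leven //; lia.
  + by move=> n; rewrite pos_mk.
Qed.

End LiftI.

Section LiftII.

Definition reply (f : utree -> utree) t1 : set T -> ucar := fun A => f (mk (tri A (inr set0) t1)).
(* The nodes that player II, following [f], would announce after some
   quasi-strategy announced by I. *)
Definition SII (r : set T -> ucar) t1 : set T := [set u | exists A, qI A t1 /\ posc (r A) = inl u].
Definition AII (r : set T -> ucar) t1 u : set T :=
  match pselect (SII r t1 u) with left e => sval (cid e) | right _ => setT end.
Definition NII (r : set T -> ucar) t1 : set T := [set s | ~ win true (SII r t1) s].
Definition BII (r : set T -> ucar) t1 : set T := if posc (r (NII r t1)) is inr B then B else set0.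

Definition phiII (f : utree -> utree) t : T :=
  if lv t <= L then pos (f (mk (tri set0 (inr set0) t))) else
  let t1 := anc L.+1 t in let r := reply f t1 in
  chase true (SII r t1) L.+1
    (fun u t => fixc t (pos (f (mk (tri (AII r t1 u) (inl u) t)))))
    (fun t => fixc t (pos (f (mk (tri (NII r t1) (inr (BII r t1)) t))))) t.

(** II pretends that I announced [NII], the nodes from which II cannot force a node of [SII]. If
    such a node [u] is reached after all, the run is reinterpreted with the announcement
    [AII r t1 u], which [f] answers by [u]. The search begins at [L.+1], because II's move there
    already answers the announcement. *)
Lemma lift_II : lifting L (pos : utree -> T) true phiII.
Proof.
split.
- move=> f sf t; rewrite /phiII; case: leqP => l; first exact: pos_strat_low.
  by apply: chase_child => [u|]; exact: fixcP.
- move=> f g t H; rewrite /phiII; case: leqP => l.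
    by rewrite H //; exact: lv_mk.
  have -> : reply f (anc L.+1 t) = reply g (anc L.+1 t).
    apply/funext => A; apply: H; apply: leq_trans (lv_mk _ _ _) _; rewrite lv_anc; lia.
  by apply: chase_ext => [u|]; rewrite H //; exact: lv_mk.
- move=> f y sf l; rewrite /phiII ifT; last exact: ltnW.
  congr (pos (f _)); rewrite -[RHS]mkK ucar_tri; congr mk; apply: tri_low; exact: ltnW.
- move=> f x sf bx fx.
  have fxlow n : odd n = true -> n <= L -> x n.+1 = pos (f (mk (tri set0 (inr set0) (x n)))).
    by move=> on nL; rewrite fx // /phiII bx.1 nL.
  set t1 := x L.+1; set r := reply f t1; set S := SII r t1.
  have rE A c : r A = f (mk (tri A c t1)).
    rewrite /r /reply; congr (f (mk _)); by rewrite /tri bx.1 leqnn.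
  have vlow A c n : n < L.+2 -> qI A t1 -> valid (tri A c (x n)).
    move=> n2 q; case: (leqP n L) => h; first by apply: valid_low; rewrite bx.1.
    have -> : n = L.+1 by lia.
    by apply: valid_mid => //; rewrite bx.1.
  have fol A c n : qI A t1 -> posc (r A) = c -> odd n = true -> valid (tri A c (x n)) ->
     (n <= L \/ x n.+1 = pos (f (mk (tri A c (x n))))) -> mk (tri A c (x n.+1)) = f (mk (tri A c (x n))).
    move=> q ec on v h; have e : x n.+1 = pos (f (mk (tri A c (x n)))).
      case: h => // h; rewrite fxlow //; congr (pos (f (mk _))); apply: tri_low; by rewrite bx.1.
    symmetry; apply: (@uchild_eq _ _ (x n)) => //; rewrite bx.1 => en.
      by move: on; rewrite en Leven.
    by rewrite en -/t1 -rE.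
  have H n : L.+1 <= n -> odd n = true -> x n.+1 = chase true S L.+1
    (fun u t => fixc t (pos (f (mk (tri (AII r t1 u) (inl u) t)))))
    (fun t => fixc t (pos (f (mk (tri (NII r t1) (inr (BII r t1)) t))))) (x n).
    move=> ln on; rewrite fx // /phiII bx.1 ifN; last lia.
    by rewrite anc_branch.
  have [[N [lN SN Nmin HN]]|[nw Hn]] := chaseP bx H.
    set u := x N in SN HN *; set A := AII r t1 u.
    have [qA ec] : qI A t1 /\ posc (r A) = inl u.
      rewrite /A /AII; case: pselect => [e|//]; by case: (cid e).
    have v1 : valid (tri A (inl u) t1) by apply: valid_mid => //; rewrite bx.1.
    have [cy1 hA1 _] := uchild_data v1 (sf (mk (tri A (inl u) t1))).
    have vr := ucar_valid (r A); have lr : lv (pos (r A)) = L.+2 by rewrite (rE A (inl u)) cy1.2 bx.1.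
    have Ar : posA (r A) = A by rewrite (rE A (inl u)) hA1 // bx.1.
    rewrite ec Ar valid_high ?lr // in vr.
    have [_ [du Au lu cu]] := vr; have lu' : L.+1 < N by rewrite /u bx.1 in lu.
    have v n : valid (tri A (inl u) (x n)).
      case: (ltnP n L.+2) => n2; first exact: vlow.
      rewrite valid_high ?bx.1 //; rewrite anc_branch //; last lia.
      split=> //; split=> // m; rewrite !bx.1 => m1 m2; by rewrite !anc_branch.
    exists (fun n => mk (tri A (inl u) (x n))); split; first exact: run_branch.
    + move=> n on; apply: fol => //.
      case: (leqP n L) => nL; [by left|right].
      have [cy _ hc] := uchild_data (v n) (sf (mk (tri A (inl u) (x n)))).
      case: (leqP N n) => Nn.
        by rewrite {1}HN // fixc_id.
      have {hc} : posc (f (mk (tri A (inl u) (x n)))) = inl u.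
        case: (eqVneq n L.+1) => [->|ne]; first by rewrite -rE.
        by apply: hc; rewrite bx.1; lia.
      set y := f _ in cy * => hc.
      have yv := ucar_valid y; have ly := cy.2; rewrite bx.1 in ly.
      move: yv; rewrite hc valid_high; last by rewrite ly; lia.
      move=> [_ [_ _ _ /(_ n.+1)]]; rewrite ly bx.1 => /(_ (leqnn _) Nn).
      by rewrite -{1}ly anc_id anc_branch.
    + by move=> n; rewrite pos_mk.
  set A := NII r t1 in Hn *.
  have qA : qI A t1.
    split=> [|s ns]; first by apply: nw; rewrite leqnn.
    case: (boolP (odd (lv s))) => os; first by move=> s' cs; exact: nwin_own cs.
    by apply: nwin_opp => //; exact: negbTE.
  have v1 c : valid (tri A c t1) by apply: valid_mid => //; rewrite bx.1.
  have [cy1 hA1 _] := uchild_data (v1 (inr set0)) (sf (mk (tri A (inr set0) t1))).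
  rewrite -(rE A) in cy1 hA1.
  have vr := ucar_valid (r A); have lr : lv (pos (r A)) = L.+2 by rewrite cy1.2 bx.1.
  have Ar : posA (r A) = A by rewrite hA1 // bx.1.
  rewrite Ar valid_high ?lr // in vr.
  set B := BII r t1 in Hn *.
  (* A node announced in answer to [NII] would have to lie in [NII], yet every node of [SII] is
     trivially winning for II. *)
  have ec : posc (r A) = inr B.
    rewrite /B /BII -/A; case E: (posc (r A)) vr => [u|//] [_ [_ Au _ _]].
    by exfalso; apply: Au; apply: win_base; exists A.
  rewrite ec in vr; have {vr} [_ [qB _]] := vr.
  have e2 : pos (r A) = x L.+2.
    rewrite [RHS]Hn //; last by rewrite /= Leven.
    by rewrite -/t1 -rE fixc_id.
  have l2 : anc L.+2 (pos (r A)) = x L.+2 by rewrite -e2 -{1}lr anc_id.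
  rewrite l2 in qB.
  have vv n : L.+2 <= n -> (forall m, L.+1 < m <= n -> B (x m)) -> valid (tri A (inr B) (x n)).
    move=> n2 Bm; rewrite valid_high ?bx.1 //; rewrite !anc_branch //; last lia.
    split=> //; split=> // m m1; rewrite anc_branch //; [exact: Bm | lia].
  have eqn n : L.+1 <= n -> odd n = true -> valid (tri A (inr B) (x n)) ->
     x n.+1 = pos (f (mk (tri A (inr B) (x n)))).
    move=> n2 on v; rewrite {1}Hn // fixc_id //.
    by have [] := uchild_data v (sf (mk (tri A (inr B) (x n)))).
  have Bx n : forall m, L.+1 < m <= n -> B (x m).
    elim: n => [|n IH] m mn; first lia.
    case: (eqVneq m n.+1) => [->|ne]; last by apply: IH; lia.
    have [->|Ln] : n = L.+1 \/ L.+2 <= n by lia.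
      exact: qB.1.
    have Bn : B (x n) by apply: IH; lia.
    have [An _] := qB.2 _ Bn; rewrite bx.1; case: (boolP (odd n)) => on; last first.
      by apply; [exact: branch_child | apply: nw; lia].
    move=> _; have v := vv n Ln IH.
    have [cy hA hc] := uchild_data v (sf (mk (tri A (inr B) (x n)))).
    rewrite eqn //; last by lia.
    set y := f _ in cy hA hc *; have := ucar_valid y; have ly := cy.2; rewrite bx.1 in ly.
    rewrite hA ?bx.1; last lia.
    rewrite hc ?bx.1 // valid_high; last by rewrite ly; lia.
    move=> [_ [_ /(_ n.+1)]]; rewrite ly leqnn -{2}ly anc_id; apply; lia.
  have v n : valid (tri A (inr B) (x n)).
    by case: (ltnP n L.+2) => n2; [exact: vlow | apply: vv => //; exact: Bx].
  exists (fun n => mk (tri A (inr B) (x n))); split; first exact: run_branch.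
  + move=> n on; apply: fol => //.
    case: (leqP n L) => nL; [by left|right]; exact: eqn.
  + by move=> n; rewrite pos_mk.
Qed.
End LiftII.

Lemma utree_covering : covering L (pos : utree -> T).
Proof.
split; first exact: pos_map.
- move=> y y' l e; apply: ucar_inj; rewrite !ucar_tri -e; exact: tri_low.
- move=> t l; exists (mk (tri set0 (inr set0) t)); rewrite pos_mk //; exact: valid_low.
- by case; [exists phiII; exact: lift_II | exists phiI; exact: lift_I].
Qed.

(** An announced dead node lies on the branch, so [X] fails; otherwise no node of the branch is
    dead, and [X] is closed. *)
Lemma utree_decides (x : nat -> utree) : branch x ->
  X (pos \o x) <-> if posc (x L.+2) is inr _ then True else False.
Proof.
move=> bx; have bp := treemap_branch pos_map bx.
have cE n : L.+2 <= n -> posc (x n) = posc (x L.+2).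
  elim: n => [|n IH] h; first lia.
  case: (eqVneq n L.+1) => [->//|ne].
  rewrite -IH; last lia.
  have v := ucar_valid (x n); have := branch_child n bx.
  rewrite -{1}(mkK (x n)) ucar_tri => c; have [_ _ ->] := uchild_data v c => //.
  by have := bx.1 n; rewrite /= => ->; lia.
have lx n : lv (pos (x n)) = n := bx.1 n.
have V n : L.+2 <= n -> qI (posA (x n)) (anc L.+1 (pos (x n))) /\
    match posc (x n) with
    | inl u => [/\ dead u, posA (x n) u, L.+1 < lv u & cmp (pos (x n)) u]
    | inr B => qII (posA (x n)) B (anc L.+2 (pos (x n))) /\
        forall m, L.+1 < m <= lv (pos (x n)) -> B (anc m (pos (x n)))
    end.
  by move=> h; apply/valid_high; [rewrite lx | exact: ucar_valid].
case E: (posc (x L.+2)) => [u|B]; split=> //.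
  move=> Xx; pose n := maxn L.+2 (lv u).
  have nL : L.+2 <= n by exact: leq_maxl.
  have := V n nL; rewrite cE // E => -[_ [du _ _ /(_ (lv u))]].
  rewrite lx anc_id leqnn => /(_ _ erefl) e.
  apply: (du (pos \o x)) => //; rewrite -[RHS]e; last exact: leq_maxr.
  by rewrite (anc_branch bp) //; exact: leq_maxr.
move=> _; apply: contrapT => /(dead_ex L.+2 bp)[n [nL dn]].
have := V n nL; rewrite cE // E => -[_ [[_ qb] /(_ n)]]; rewrite lx leqnn nL => /(_ erefl) Bn.
have := qb _ Bn; rewrite (anc_branch bp (leqnn n)) => -[_ ]; exact.
Qed.

End Unravel.

(** * Borel determinacy and the Lipschitz game *)

Section TreeBorel.
Implicit Types T : tree.

Definition topen T (X : set (nat -> T)) := forall x, branch x -> X x ->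
  exists n, forall y, branch y -> y n = x n -> X y.
Definition tclopen T (X : set (nat -> T)) := topen X /\ topen (~` X).

Lemma topen_preimage T' T (p : T' -> T) (X : set (nat -> T)) : treemap p ->
  topen X -> topen [set x | X (p \o x)].
Proof.
move=> pm oX x bx Xx; have [n Hn] := oX _ (treemap_branch pm bx) Xx.
by exists n => y By e; apply: Hn; [exact: treemap_branch | rewrite /= e].
Qed.

Lemma tclopen_preimage T' T (p : T' -> T) (X : set (nat -> T)) : treemap p ->
  tclopen X -> tclopen [set x | X (p \o x)].
Proof. by move=> pm [clX opC]; split; [exact: topen_preimage|exact: (topen_preimage pm opC)]. Qed.

Lemma topen_unravel T (X : set (nat -> T)) K : topen X ->
  exists T' (p : T' -> T), covering K p /\ tclopen [set x | X (p \o x)].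
Proof.
(* Doubling gives an even level that is at least [K]. *)
move=> oX; pose L := K.*2; have Le : odd L = false by rewrite /L odd_double.
have cl : forall x, branch x -> ~ (~` X) x -> exists n, forall y, branch y -> y n = x n -> ~ (~` X) y.
  move=> x bx /contrapT Xx; have [n Hn] := oX x bx Xx.
  by exists n => y By e; apply; exact: Hn.
exists (utree (~` X) Le), (@pos _ _ _); split.
  by apply: (@covering_le L); [rewrite /L; lia | exact: utree_covering].
have D := @utree_decides _ _ _ Le cl.
have D' (x y : nat -> utree (~` X) Le) : branch x -> branch y -> y L.+2 = x L.+2 -> X (@pos _ (~` X) L \o x) -> X (@pos _ (~` X) L \o y).
  move=> bx By e Xx; apply: contrapT => nX.
  by have := (D y By).1 nX; rewrite e => /(D x bx).2; apply.
split=> x bx Xx; exists L.+2 => y By e; first exact: D' Xx.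
by move=> Xy; apply: Xx; apply: D' Xy.
Qed.

(* Quantifying over all trees above [T] makes the class closed under countable
   unions. *)
Definition unravelable T (X : set (nat -> T)) := forall T' (q : T' -> T), treemap q -> forall K,
  exists T'' (p : T'' -> T'), covering K p /\ tclopen [set x | X (q \o p \o x)].

Lemma unravelable_open T (X : set (nat -> T)) : topen X -> unravelable X.
Proof. by move=> oX T' q qm K; exact: (topen_unravel K (topen_preimage qm oX)). Qed.

Lemma unravelable_setC T (X : set (nat -> T)) : unravelable X -> unravelable (~` X).
Proof.
move=> hX T' q qm K; have [T'' [p [pc [clX opC]]]] := hX T' q qm K.
exists T'', p; split=> //; split=> // x bx Xx.
have [n Hn] := clX x bx (contrapT Xx).
by exists n => y By e; apply; exact: Hn.
Qed.

Record over T := Over { ov_tree : tree; ov_map : ov_tree -> T; ov_tm : treemap ov_map }.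

(** The sets [X i] are unravelled one after another, the [i]-th by a covering faithful up to level
    [K + i]; on the limit tree the union is open, and it is unravelled once more. *)
Lemma unravelable_bigcup T (X : nat -> set (nat -> T)) : (forall i, unravelable (X i)) ->
  unravelable [set x | exists i, X i x].
Proof.
move=> hX T' q qm K.
have step i (S : over T') : {S' : over T' & {p : ov_tree S' -> ov_tree S |
   [/\ covering (K + i) p, @ov_map _ S' = @ov_map _ S \o p &
     tclopen [set x | X i (q \o @ov_map _ S' \o x)]]}}.
  case: S => T1 m1 tm1.
  have /cid[T2 /cid[p [pc cl]]] := hX i T1 (q \o m1) (treemap_comp tm1 qm) (K + i).
  exists (Over (treemap_comp (cov_map pc) tm1)) => /=.
  by exists p; split.
have idm : treemap (@id T') by [].
pose S := nat_rect (fun _ => over T') (Over idm) (fun i S => projT1 (step i S)).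
pose F i := ov_tree (S i).
pose p i : F i.+1 -> F i := sval (projT2 (step i (S i))).
have pP i := svalP (projT2 (step i (S i))).
have pcov i : covering (K + i) (p i) by case: (pP i).
have mE i : @ov_map _ (S i.+1) = @ov_map _ (S i) \o p i by case: (pP i).
have clS i : tclopen [set x | X i (q \o @ov_map _ (S i.+1) \o x)] by case: (pP i).
pose TT := limit_tree pcov; pose l0 : TT -> T' := @lim_proj _ _ _ pcov 0.
have lE i (t : TT) : @ov_map _ (S i) (lim_proj i t) = l0 t.
  elim: i => // i IH; rewrite mE /=; rewrite -[RHS]IH; congr ov_map.
  exact: (thrE t i).
have cl i : topen [set x : nat -> TT | X i (q \o l0 \o x)].
  have := (tclopen_preimage (lim_proj_map pcov i.+1) (clS i)).1.
  congr topen; apply/seteqP; split=> x /=;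
    (rewrite (_ : q \o @ov_map _ (S i.+1) \o (lim_proj i.+1 \o x) = q \o l0 \o x) //;
     apply/funext => n; exact: (congr1 q (lE i.+1 (x n)))).
have oU : topen [set x : nat -> TT | exists i, X i (q \o l0 \o x)].
  move=> x bx [i Xi]; have [n Hn] := cl i x bx Xi.
  by exists n => y By e; exists i; exact: Hn.
have [T2 [r [rc rcl]]] := topen_unravel K oU.
exists T2, (l0 \o r); split=> //.
by apply: covering_comp => //; exact: limit_covering.
Qed.

Lemma unravelable_det T (X : set (nat -> T)) : unravelable X ->
  (exists f, strat f /\ forall x, branch x -> follows false f x -> X x) \/
  (exists f, strat f /\ forall x, branch x -> follows true f x -> ~ X x).
Proof.
move=> hX; have idm : treemap (@id T) by [].
have [T' [p [pc [clX opC]]]] := hX T id idm 0.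
(* For a clopen payoff, a branch belongs to it exactly when it meets such a node. *)
pose G (t : T') := forall y, branch y -> y (lv t) = t -> X (p \o y).
have [[f [sf Hf]]|[f [sf Hf]]] := open_game false G; [left|right].
  have [phi phiP] := cov_lift pc false.
  exists (phi f); split=> [|x bx fx]; first exact: lift_strat phiP _ sf.
  have [x' [bx' fx' e]] := lift_branch phiP sf bx fx.
  have [n Gn] := Hf x' bx' fx'.
  have -> : x = p \o x' by apply/funext => k /=; rewrite e.
  by apply: Gn => //; rewrite bx'.1.
have [phi phiP] := cov_lift pc true.
exists (phi f); split=> [|x bx fx]; first exact: lift_strat phiP _ sf.
have [x' [bx' fx' e]] := lift_branch phiP sf bx fx.
have -> : x = p \o x' by apply/funext => k /=; rewrite e.
move=> Xx; have [n Hn] := clX x' bx' Xx.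
by apply: (Hf x' bx' fx' n) => y By; rewrite bx'.1; exact: Hn.
Qed.
End TreeBorel.

(** * Inductive Borel sets and Wadge's lemma *)

Definition agree n (x y : nat -> nat) := forall i, i < n -> x i = y i.
Definition sopen (X : set (nat -> nat)) := forall x, X x -> exists n, forall y, agree n x y -> X y.

Inductive borelN : set (nat -> nat) -> Prop :=
| borelN_open X : sopen X -> borelN X
| borelN_setC X : borelN X -> borelN (~` X)
| borelN_bigcup (X : nat -> set (nat -> nat)) : (forall i, borelN (X i)) -> borelN [set x | exists i, X i x].

Definition scont (h : (nat -> nat) -> nat -> nat) :=
  forall x n, exists m, forall y, agree m x y -> agree n (h x) (h y).

Lemma borelN_preimage h X : scont h -> borelN X -> borelN [set x | X (h x)].
Proof.
move=> ch; elim=> {X} [X oX|X _ IH|X _ IH].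
- apply: borelN_open => x /= Xx; have [n Hn] := oX _ Xx; have [m Hm] := ch x n.
  by exists m => y a; apply: Hn; exact: Hm.
- exact: borelN_setC.
- exact: (borelN_bigcup IH).
Qed.

Lemma borelN_setU X Y : borelN X -> borelN Y -> borelN (X `|` Y).
Proof.
move=> bX bY.
have -> : X `|` Y = [set x | exists i, (fun i => if i is 0 then X else Y) i x].
  apply/seteqP; split=> x /=; first by case=> h; [exists 0 | exists 1].
  by case=> -[|i] h; [left|right].
by apply: borelN_bigcup => -[|i].
Qed.

Lemma borelN_setI X Y : borelN X -> borelN Y -> borelN (X `&` Y).
Proof.
move=> bX bY; rewrite -[X `&` Y]setCK setCI.
by apply: borelN_setC; apply: borelN_setU; exact: borelN_setC.
Qed.

Section NatTree.

Lemma nat_child_ex (s : seq nat) : exists t : seq nat, behead t = s /\ size t = (size s).+1.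
Proof. by exists (0 :: s). Qed.

Definition nat_tree : tree :=
  @Tree (seq nat) size behead [::] erefl (@size0nil nat) (@size_behead nat) nat_child_ex.

Definition moves (x : nat -> nat_tree) : nat -> nat := fun n => head 0 (x n.+1).

Lemma borelN_unravelable X : borelN X -> unravelable [set x | X (moves x)].
Proof.
elim=> {X} [X oX|X _ IH|X _ IH].
- apply: unravelable_open => x bx Xx; have [n Hn] := oX _ Xx.
  exists n.+1 => y By e; apply: Hn => i ni; rewrite /moves.
  by rewrite (branch_agree By bx e (leqW ni)).
- exact: unravelable_setC.
- exact: unravelable_bigcup.
Qed.

(* Player [b] uses [g], the opponent plays [x]; the last move comes first. *)
Fixpoint play (b : bool) (g : seq nat -> nat) (x : nat -> nat) n : seq nat :=
  if n is n'.+1 then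
    let s := play b g x n' in (if odd n' == b then g s else x n'./2) :: s
  else [::].

Lemma play_branch b g x : @branch nat_tree (play b g x).
Proof. by split=> // n /=; elim: n => //= n ->. Qed.

(** When [b] is player I, one more own move precedes the next unknown move of the opponent, whence
    [~~ b]. *)
Lemma play_agree b g x y k n : agree k x y -> n <= k.*2 + ~~ b -> play b g x n = play b g y n.
Proof.
move=> a; elim: n => //= n IH nk; rewrite IH; last lia.
case: eqP => // /eqP ob; congr (_ :: _); apply: a.
by move: ob nk; clear; case: b => /=; have := odd_double_half n; case: (odd n) => //=; lia.
Qed.

(* [e = 0]: Lipschitz; [e = 1]: contracting. *)
Definition Lipn e (h : (nat -> nat) -> nat -> nat) :=
  forall n x y, agree n x y -> agree (n + e) (h x) (h y).

Definition answer b g x : nat -> nat := fun i => g (play b g x (i.*2 + b)).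

Lemma answer_Lip b g : Lipn (~~ b) (answer b g).
Proof.
move=> n x y a i ni; rewrite /answer; congr (g _); apply: (@play_agree b g x y n) => //.
case: b ni => /=; lia.
Qed.

Definition evens (f : nat -> nat) := fun n => f n.*2.
Definition odds (f : nat -> nat) := fun n => f n.*2.+1.

Lemma scont_evens : scont evens.
Proof. by move=> x n; exists n.*2 => y a i ni; apply: a; lia. Qed.
Lemma scont_odds : scont odds.
Proof. by move=> x n; exists n.*2.+1 => y a i ni; apply: a; lia. Qed.

(** Wadge's game: I plays the even moves, II the odd ones, and I wins if exactly one of the two
    points lies in its set. I moves first, so a strategy of I produces [n.+1] values from [n] and
    contracts. *)
Lemma Lipschitz_det (A B : set (nat -> nat)) : borelN A -> borelN B ->
  (exists h, Lipn 0 h /\ forall x, A x <-> B (h x)) \/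
  (exists h, Lipn 1 h /\ forall y, B y <-> ~ A (h y)).
Proof.
move=> bA bB.
pose Z := [set f : nat -> nat | ~ (A (evens f) <-> B (odds f))].
have bZ : borelN Z.
  have bA' := borelN_preimage scont_evens bA; have bB' := borelN_preimage scont_odds bB.
  have -> : Z = ([set f | A (evens f)] `&` ~` [set f | B (odds f)]) `|`
                (~` [set f | A (evens f)] `&` [set f | B (odds f)]).
    apply/seteqP; split=> f; rewrite /Z /=.
      move=> H; case: (pselect (A (evens f))) => a; case: (pselect (B (odds f))) => b; tauto.
    by tauto.
  by apply: borelN_setU; apply: borelN_setI => //; exact: borelN_setC.
have [[f [sf Hf]]|[f [sf Hf]]] := unravelable_det (borelN_unravelable bZ); [right|left].
all: pose g (s : seq nat) := head 0 (f s).
all: have fE (s : seq nat) : f s = g s :: s by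
  have := sf s; rewrite /g; case: (f s) => [|a l] [//= -> _].
- exists (answer false g); split=> [|y]; first exact: (@answer_Lip false g).
  have By := play_branch false g y.
  have fol : @follows nat_tree false f (play false g y) by move=> n on; rewrite /= on fE.
  have := Hf _ By fol; rewrite /Z /=.
  have -> : evens (@moves (play false g y)) = answer false g y.
    by apply/funext => i; rewrite /evens /moves /= odd_double /answer addn0.
  have -> : odds (@moves (play false g y)) = y.
    by apply/funext => i; rewrite /odds /moves /= odd_double /= uphalf_double.
  case: (pselect (A (answer false g y))); case: (pselect (B y)); tauto.
- exists (answer true g); split=> [|x]; first exact: (@answer_Lip true g).
  have bx := play_branch true g x.
  have fol : @follows nat_tree true f (play true g x) by move=> n on; rewrite /= on fE.
  have := Hf _ bx fol; rewrite /Z /=.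
  have -> : odds (@moves (play true g x)) = answer true g x.
    by apply/funext => i; rewrite /odds /moves /= odd_double /answer addn1 /= odd_double.
  have -> : evens (@moves (play true g x)) = x.
    by apply/funext => i; rewrite /evens /moves /= odd_double /= half_double.
  by move=> /contrapT.
Qed.
End NatTree.

(** * The word game *)

(* A discrete ultrametric space whose distances have order type omega* :
   [eqlev k] is "at distance at most the [k]-th", [isolev u] is a level isolating
   [u], and the [cone k] are the balls around the only missing point of the completion. *)
Record ultra (S : Type) := Ultra {
  eqlev : nat -> S -> S -> Prop;
  isolev : S -> nat;
  cone : nat -> S -> Prop;
  E_refl : forall k u, eqlev k u u;
  E_sym : forall k u v, eqlev k u v -> eqlev k v u;
  E_trans : forall k u v w, eqlev k u v -> eqlev k v w -> eqlev k u w;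
  E_le : forall j k u v, j <= k -> eqlev k u v -> eqlev j u v;
  E_0 : forall u v, eqlev 0 u v;
  E_iso : forall u v, eqlev (isolev u) u v -> u = v;
  C_le : forall j k u, j <= k -> cone k u -> cone j u;
  C_ex : forall k, exists u, cone k u;
  C_E : forall k u v, cone k u -> cone k v -> eqlev k u v;
  E_C : forall k u v, cone k u -> eqlev k u v -> cone k v;
  nC_K : forall k u v, ~ cone k u -> eqlev k u v -> isolev u = isolev v;
  nC : forall u, ~ cone (isolev u) u;
  C_deep : exists k0, forall u, cone k0 u -> cone (isolev u).-1 u }.

Lemma cid_eq (S : Type) (P Q : S -> Prop) (p : exists u, P u) (q : exists u, Q u) :
  P = Q -> sval (cid p) = sval (cid q).
Proof. by move=> e; subst Q; rewrite (Prop_irrelevance p q). Qed.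

Section Dichotomy.
Variables (S : Type) (W : ultra S).
Local Notation E := (eqlev W).
Local Notation K := (isolev W).
Local Notation C := (cone W).

Definition Epres (F : S -> S) := forall k u v, E k u v -> E k (F u) (F v).
Definition Econtr (G : S -> S) := forall k u v, E k u v -> E k.+1 (G u) (G v).
(* As a strategy of I in the ball game: if II stays in the cone forever, I does not. *)
Definition leaving (G : S -> S) := exists j s, forall u, C j u -> G u = s.

Lemma iso_lt k u v : E k u v -> u <> v -> k < K u.
Proof.
move=> e ne; rewrite ltnNge; apply/negP => h; apply: ne; apply: (E_iso (u0 := W)).
exact: E_le e.
Qed.

(** The choice depends on the ball [E k u] alone, so strategies built from [rep] are functions of
    balls. *)
Definition rep k (u : S) : S := sval (cid (ex_intro (E k u) u (E_refl W k u))).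
Lemma repP k u : E k u (rep k u).
Proof. exact: (svalP (cid (ex_intro (E k u) u (E_refl W k u)))). Qed.
Lemma rep_eq k u v : E k u v -> rep k u = rep k v.
Proof.
move=> e; have Euv : E k u = E k v.
  apply/funext => w; apply/propext; split; last exact: E_trans.
  by apply: E_trans; exact: E_sym.
exact: cid_eq.
Qed.

Variable P : S -> S -> Prop.

(* II wins the ball game from the position where I has played the [k]-ball of [u]
   and II that of [v]. *)
Definition wins2 k u v := exists F : S -> S,
  (forall w, E k u w -> E k v (F w) /\ P w (F w)) /\
  (forall j w w', k <= j -> E k u w -> E j w w' -> E j (F w) (F w')).

(** The winning functions on the [k.+1]-balls are amalgamated; using a single one per ball preserves
    [E]. *)
Lemma wins2_step k u v :
  (forall u', E k u u' -> exists v', E k v v' /\ wins2 k.+1 u' v') -> wins2 k u v.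
Proof.
move=> H.
have /choice[g Hg] : forall u', exists F : S -> S, E k u u' -> exists v', E k v v' /\
   ((forall w, E k.+1 u' w -> E k.+1 v' (F w) /\ P w (F w)) /\
   (forall j w w', k.+1 <= j -> E k.+1 u' w -> E j w w' -> E j (F w) (F w'))).
  move=> u'; case: (pselect (E k u u')) => [e|ne].
    by have [v' [e' [F HF]]] := H u' e; exists F => _; exists v'.
  by exists id.
have ur w : E k u w -> E k u (rep k.+1 w).
  move=> e; apply: E_trans e _; apply: (@E_le _ W k k.+1) => //; exact: repP.
have rw w : E k.+1 (rep k.+1 w) w by apply: E_sym; exact: repP.
have Fk w : E k u w -> E k v (g (rep k.+1 w) w) /\ P w (g (rep k.+1 w) w).
  move=> e; have [v' [e' [H1 _]]] := Hg _ (ur w e).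
  have [e2 p2] := H1 w (rw w); split=> //; apply: E_trans e' _.
  exact: (@E_le _ W k k.+1).
exists (fun w => g (rep k.+1 w) w); split=> // j w w' kj uw ww'.
case: (eqVneq j k) => [ej|ne].
  rewrite ej in ww' *; have [e1 _] := Fk _ uw; have [e2 _] := Fk _ (E_trans uw ww').
  by apply: E_trans e2; exact: E_sym.
have kj' : k < j by lia.
rewrite -(rep_eq (E_le kj' ww')).
have [v' [e' [_ H2]]] := Hg _ (ur w uw).
by apply: H2 => //; exact: rw.
Qed.

Definition mv k u v : S :=
  match pselect (exists u', E k u u' /\ forall v', E k v v' -> ~ wins2 k.+1 u' v') with
  | left e => sval (cid e) | right _ => u end.

Lemma mv_E k u v : E k u (mv k u v).
Proof. by rewrite /mv; case: pselect => [e|_]; [case: cid => u' []|exact: E_refl]. Qed.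

Lemma mvP k u v : ~ wins2 k u v -> forall v', E k v v' -> ~ wins2 k.+1 (mv k u v) v'.
Proof.
move=> nw; rewrite /mv; case: pselect => [e|ne]; first by case: cid => u' [].
exfalso; apply: nw; apply: wins2_step => u' e; apply: contrapT => H; apply: ne.
by exists u'; split=> // v' e' w; apply: H; exists v'.
Qed.

(** I's play against the balls shrinking to [v]. Through [rep k' v] each move sees only a ball,
    which is the origin of the contraction. *)
Fixpoint runU (u0 : S) (v : S) k : S :=
  if k is k'.+1 then mv k' (runU u0 v k') (rep k' v) else u0.

Lemma runU_eq u0 v v' k : E k v v' -> runU u0 v k.+1 = runU u0 v' k.+1.
Proof.
move=> e /=; rewrite (rep_eq e); congr mv.
elim: k e => //= k IH e; have e' : E k v v' by apply: E_le e.
by rewrite (rep_eq e') IH.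
Qed.

Lemma runU_E u0 v j k : j <= k -> E j (runU u0 v j) (runU u0 v k).
Proof.
elim: k => [|k IH] jk; first by have -> : j = 0 by [lia]; exact: E_refl.
case: (eqVneq j k.+1) => [->|ne]; first exact: E_refl.
have jk' : j <= k by lia.
apply: E_trans (IH jk') _; apply: E_le jk' _; exact: mv_E.
Qed.

Lemma runU_nwins u0 v k : ~ wins2 0 u0 v -> ~ wins2 k (runU u0 v k) v.
Proof.
move=> nw; elim: k => //= k IH.
have IH' : ~ wins2 k (runU u0 v k) (rep k v).
  move=> [F [H1 H2]]; apply: IH; exists F; split=> // w e; have [e1 p1] := H1 w e.
  by split=> //; apply: E_trans e1; exact: repP.
by apply: (mvP IH'); apply: E_sym; exact: repP.
Qed.

(** Otherwise II wins by answering each [w] inside the cone of level [(K w).-1]: distinct words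
    agreeing at level [j] are isolated above [j], so both answers lie in cone [j]. The word obtained
    serves as a constant answer of I deep in the cones. *)
Lemma nwins_cone k u v : (forall w, C k w -> C (K w).-1 w) -> C k u -> C k v -> ~ wins2 k u v ->
  exists w, [/\ C k w, C (K w).-1 w, k <= (K w).-1 & forall v', C (K w).-1 v' -> ~ P w v'].
Proof.
move=> deep Cu Cv nw.
have kK w : C k w -> k < K w.
  move=> Cw; rewrite ltnNge; apply/negP => h; apply: (nC (u0 := W) (u := w)); exact: C_le h Cw.
apply: contrapT => H; apply: nw.
have /choice[F HF] : forall w, exists v', C k w -> C (K w).-1 v' /\ P w v'.
  move=> w; case: (pselect (C k w)) => [Cw|]; last by exists w.
  apply: contrapT => H2; apply: H; exists w; split=> //; [exact: deep | by have := kK w Cw; lia |].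
  by move=> v' Cv' p; apply: H2; exists v'.
exists F; split=> [w e|j w w' kj e e'].
  have Cw := E_C Cu e; have [C' p] := HF w Cw; split=> //.
  by apply: C_E => //; apply: C_le C'; have := kK w Cw; lia.
case: (pselect (w = w')) => [->|ne]; first exact: E_refl.
have Cw := E_C Cu e; have Cw' : C k w' by apply: (E_C Cw); exact: E_le e'.
have l1 := iso_lt e' ne; have l2 : j < K w' by apply: (iso_lt (E_sym e')); exact: nesym.
by apply: C_E; [apply: C_le (HF w Cw).1 | apply: C_le (HF w' Cw').1]; lia.
Qed.

Lemma dichotomy : (exists F, Epres F /\ forall w, P w (F w)) \/
  (exists G, [/\ Econtr G, leaving G & forall w, ~ P (G w) w]).
Proof.
have [base _] := C_ex W 0.
case: (pselect (wins2 0 base base)) => [[F [H1 H2]]|nw]; [left|right].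
  exists F; split=> [k u v e|w]; last by apply: (H1 w _).2; exact: E_0.
  by apply: H2 => //; exact: E_0.
have nw0 v : ~ wins2 0 base v.
  move=> [F [H1 H2]]; apply: nw; exists F; split=> // w e; split; first exact: E_0.
  exact: (H1 w e).2.
(* At level [K v] II's ball is [v] alone; if [P s v] held for every [s] in I's ball, the constant
   [v] would win for II. *)
have /choice[G HG] : forall v, exists s, E (K v) (runU base v (K v)) s /\ ~ P s v.
  move=> v; apply: contrapT => H; apply: (runU_nwins (nw0 v) (k := K v)).
  exists (fun=> v); split=> [w e|j w w' _ _ _]; last exact: E_refl.
  split; first exact: E_refl.
  by apply: contrapT => np; apply: H; exists w.
have GU v k : k <= K v -> E k (runU base v k) (G v).
  move=> kK; apply: (E_trans (runU_E base v kK)); apply: E_le kK _; exact: (HG v).1.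
have cG : Econtr G.
  move=> k u v e; case: (pselect (u = v)) => [->|ne]; first exact: E_refl.
  have l1 := iso_lt e ne; have l2 : k < K v by apply: (iso_lt (E_sym e)); exact: nesym.
  apply: (E_trans (E_sym (GU _ _ l1))); rewrite (runU_eq base e); exact: GU.
have Gnw v k : k <= K v -> ~ wins2 k (G v) v.
  move=> kK [F [H1 H2]]; apply: (runU_nwins (nw0 v) (k := k)).
  exists F; split=> [w e|j w w' kj e].
    by apply: H1; apply: E_trans e; apply: E_sym; exact: GU.
  by apply: H2 => //; apply: E_trans e; apply: E_sym; exact: GU.
(* If [G] throws some word out of a cone, contraction already makes it constant deep in the
   cones. *)
case: (pselect (exists i v, C i v /\ ~ C i (G v))) => [[i [v [Cv nCv]]]|H].
  exists G; split=> //; last by move=> w; exact: (HG w).2.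
  pose k := maxn i (K (G v)).
  have [base' Co'] := C_ex W k.
  exists k, (G base') => u Cu.
  have eu : E k.+1 (G base') (G u) by apply: cG; exact: C_E.
  have vo : E i (G v) (G base').
    apply: (@E_le _ W i i.+1) => //; apply: cG; apply: C_E => //; apply: C_le Co'; exact: leq_maxl.
  symmetry; apply: (E_iso (u0 := W)); rewrite -(nC_K nCv vo); apply: E_le eu.
  by rewrite /k; have := leq_maxr i (K (G v)); lia.
have GC i v : C i v -> C i (G v).
  by move=> Cv; apply: contrapT => nCv; apply: H; exists i, v.
have [k0 deep] := C_deep W.
have [v Cv] := C_ex W k0.
have kv : k0 <= K v.
  by apply: contrapT => h; apply: (nC (u0 := W) (u := v)); apply: C_le Cv; lia.
have [w [Cw Cjw k0j npw]] := nwins_cone deep (GC _ _ Cv) Cv (Gnw v k0 kv).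
set j := (K w).-1 in Cjw k0j npw.
(* Here [G] preserves the cones. It is overwritten on cone [j] by [w], which lies in that cone, so
   contraction survives. *)
exists (fun u => if pselect (C j u) then w else G u); split.
- have main k u u' : C j u -> ~ C j u' -> E k u u' -> E k.+1 w (G u').
    move=> Cu nCu' e.
    have kj : k < j.
      by rewrite ltnNge; apply/negP => h; apply: nCu'; apply: (E_C Cu); exact: E_le e.
    apply: C_E; first exact: C_le Cjw.
    apply: (E_C (u := G u)); last exact: cG.
    by apply: C_le (GC _ _ Cu).
  move=> k u u' e; case: pselect => /= Cu; case: pselect => /= Cu'.
  + exact: E_refl.
  + exact: main e.
  + by apply: E_sym; apply: (main k u') => //; exact: E_sym.
  + exact: cG.
- by exists j, w => u Cu; case: pselect.
- by move=> u; case: pselect => /= Cu; [exact: npw | exact: (HG u).2].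
Qed.
End Dichotomy.

(** * Baire category and the Martin-Monk argument *)

Section Baire.
Implicit Types (z : nat -> bool) (D Z U V : set (nat -> bool)).

Definition bagree n z z' := forall i, i < n -> z i = z' i.
Definition bopen U := forall z, U z -> exists n, forall z', bagree n z z' -> U z'.
Definition bdense U := forall z n, exists z', bagree n z z' /\ U z'.

Lemma baire (D : nat -> set (nat -> bool)) z0 n0 : (forall i, bopen (D i) /\ bdense (D i)) ->
  exists z, bagree n0 z0 z /\ forall i, D i z.
Proof.
move=> HD.
have step k (q : (nat -> bool) * nat) : {q' : (nat -> bool) * nat | [/\ bagree q.2 q.1 q'.1, q.2 < q'.2 &
    forall z, bagree q'.2 q'.1 z -> D k z]}.
  apply: cid; have [opn d] := HD k; have [z' [a Dz']] := d q.1 q.2.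
  have [m Hm] := opn _ Dz'; exists (z', (maxn q.2 m).+1); split=> //=.
    by rewrite ltnS leq_maxl.
  by move=> z az; apply: Hm => i im; apply: az; apply: leq_trans im _; rewrite leqW // leq_maxr.
pose q := nat_rect (fun _ => ((nat -> bool) * nat)%type) (z0, n0) (fun k q => sval (step k q)).
have qP k : [/\ bagree (q k).2 (q k).1 (q k.+1).1, (q k).2 < (q k.+1).2 &
    forall z, bagree (q k.+1).2 (q k.+1).1 z -> D k z] by exact: (svalP (step k (q k))).
have qn j k : j <= k -> (q j).2 <= (q k).2.
  elim: k => [|k IH] jk; first by have -> : j = 0 by lia.
  case: (eqVneq j k.+1) => [->//|ne]; have [_ l _] := qP k.
  by apply: leq_trans (ltnW l); apply: IH; lia.
have qk k : k <= (q k).2.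
  by elim: k => // k IH; have [_ l _] := qP k; lia.
have qa j k : j <= k -> bagree (q j).2 (q j).1 (q k).1.
  elim: k => [|k IH] jk; first by have -> : j = 0 by lia.
  case: (eqVneq j k.+1) => [->//|ne] i ii; rewrite IH //; last lia.
  have [a _ _] := qP k; apply: a; apply: leq_trans ii _; apply: qn; lia.
exists (fun i => (q i.+1).1 i); split=> [i ii|k].
  by rewrite -(qa 0 i.+1).
have [_ _ H] := qP k; apply: H => i ii.
case: (leqP i.+1 k.+1) => h; last by rewrite (qa k.+1 i.+1) // ltnW.
by rewrite (qa i.+1 k.+1) //; have := qk i.+1; lia.
Qed.

(** The Baire property in a form symmetric under complement: on a comeagre set, two open sets with
    dense union decide [Z]. *)
Definition baire_prop Z := exists (D : nat -> set (nat -> bool)) U V,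
  [/\ forall i, bopen (D i) /\ bdense (D i), bopen U, bopen V, bdense (U `|` V) &
   forall z, (forall i, D i z) -> (U z -> Z z) /\ (V z -> ~ Z z)].

Lemma baire_prop_setC Z : baire_prop Z -> baire_prop (~` Z).
Proof.
move=> [D [U [V [HD oU oV dUV H]]]]; exists D, V, U; split=> //; first by rewrite setUC.
by move=> z Dz; have [h1 h2] := H z Dz; split=> // u; apply; exact: h1.
Qed.

Lemma bopen_setU U V : bopen U -> bopen V -> bopen (U `|` V).
Proof.
by move=> oU oV z [/oU[n Hn]|/oV[n Hn]]; exists n => z' a; [left|right]; exact: Hn.
Qed.

Lemma baire_prop_open U : bopen U -> baire_prop U.
Proof.
move=> oU; pose V := [set z | exists n, forall z', bagree n z z' -> ~ U z'].
exists (fun=> setT), U, V; split=> //.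
- by move=> _; split=> [z _|z n]; [exists 0 | exists z].
- move=> z [n Hn]; exists n => z' a; exists n => z'' a'; apply: Hn => i ii; by rewrite a // a'.
- move=> z n; case: (pselect (exists z', bagree n z z' /\ U z')) => [[z' [a Uz]]|H].
    by exists z'; split=> //; left.
  by exists z; split=> //; right; exists n => z' a Uz; apply: H; exists z'.
- by move=> z _; split=> // -[n Hn]; exact: Hn.
Qed.

Lemma baire_prop_bigcup (Z : nat -> set (nat -> bool)) : (forall i, baire_prop (Z i)) -> baire_prop [set z | exists i, Z i z].
Proof.
move=> /choice[D /choice[U /choice[V H]]].
pose UU := [set z | exists i, U i z].
pose VV := [set z | exists n, forall z', bagree n z z' -> ~ UU z'].
(* The unions of [U i] and [V i] are included so that a generic point outside all [U i] lies in
   every [V i]. *)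
pose DD k := if odd k then U k./2 `|` V k./2 else
  (if choice.unpickle k./2 is Some (i, j) then D i j else setT).
exists DD, UU, VV; split.
- move=> k; rewrite /DD; case: ifP => _.
    by have [_ oU oV d _] := H k./2; split=> //; exact: bopen_setU.
  case: choice.unpickle => [[i j]|]; first by have [HD _ _ _ _] := H i; exact: HD.
  by split=> [z _|z n]; [exists 0 | exists z].
- move=> z [i Ui]; have [_ oU _ _ _] := H i; have [n Hn] := oU z Ui.
  by exists n => z' a; exists i; exact: Hn.
- move=> z [n Hn]; exists n => z' a; exists n => z'' a'; apply: Hn => i ii; by rewrite a // a'.
- move=> z n; case: (pselect (exists z', bagree n z z' /\ UU z')) => [[z' [a Uz]]|H'].
    by exists z'; split=> //; left.
  by exists z; split=> //; right; exists n => z' a Uz; apply: H'; exists z'.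
- move=> z Dz.
  have Dij i j : D i j z.
    have := Dz (choice.pickle (i, j)).*2; by rewrite /DD odd_double half_double choice.pickleK.
  have UVi i : (U i `|` V i) z.
    by have := Dz i.*2.+1; rewrite /DD /= odd_double /= uphalf_double.
  split.
    move=> [i Ui]; exists i; have [_ _ _ _ h] := H i; exact: (h z (Dij i)).1.
  move=> [n Hn] [i Zi]; have [_ _ _ _ h] := H i; have [_ h2] := h z (Dij i).
  case: (UVi i) => [Ui|/h2]; last by [].
  by apply: (Hn z) => //; exists i.
Qed.

Lemma baire_prop_preimage (xi : (nat -> bool) -> nat -> nat) (X : set (nat -> nat)) :
  (forall z n, exists m, forall z', bagree m z z' -> agree n (xi z) (xi z')) ->
  borelN X -> baire_prop [set z | X (xi z)].
Proof.
move=> cxi; elim=> {X} [X oX|X _ IH|X _ IH].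
- apply: baire_prop_open => z /= Xz; have [n Hn] := oX _ Xz; have [m Hm] := cxi z n.
  by exists m => z' a; apply: Hn; exact: Hm.
- exact: baire_prop_setC.
- exact: baire_prop_bigcup.
Qed.

Definition flip k z : nat -> bool := fun i => if i == k then ~~ z i else z i.

Lemma flipK k z : flip k (flip k z) = z.
Proof. by apply/funext => i; rewrite /flip; case: eqP => // _; rewrite negbK. Qed.

Lemma flip_agree k n z z' : bagree n z z' -> bagree n (flip k z) (flip k z').
Proof. by move=> a i ii; rewrite /flip a. Qed.

(** On a cylinder where [Z] is decided, flipping the first bit beyond it stays inside; a point
    generic together with its flip gives the contradiction. *)
Lemma no_flip_set Z : baire_prop Z -> ~ (forall k z, Z (flip k z) <-> ~ Z z).
Proof.
move=> [D [U [V [HD oU oV dUV H]]]] F.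
have [z0 [_ UVz0]] := dUV (fun=> false) 0.
have [n1 Hn1] : exists n, (forall z, bagree n z0 z -> U z) \/ (forall z, bagree n z0 z -> V z).
  by case: UVz0 => [/oU[m Hm]|/oV[m Hm]]; exists m; [left|right].
pose DD k := if odd k then [set z | D k./2 (flip n1 z)] else D k./2.
have HDD k : bopen (DD k) /\ bdense (DD k).
  rewrite /DD; have [opn d] := HD k./2; case: ifP => _ //; split=> [z /= Dz|z m].
    by have [m Hm] := opn _ Dz; exists m => z' a; apply: Hm; exact: flip_agree.
  have [z' [a Dz']] := d (flip n1 z) m; exists (flip n1 z'); split=> /=.
    by rewrite -[z](flipK n1); exact: flip_agree.
  by rewrite flipK.
have [z [a Dz]] := baire z0 n1 HDD.
have D1 i : D i z by have := Dz i.*2; rewrite /DD odd_double half_double.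
have D2 i : D i (flip n1 z) by have := Dz i.*2.+1; rewrite /DD /= odd_double /= uphalf_double.
have a2 : bagree n1 z0 (flip n1 z).
  by move=> i ii; rewrite /flip; case: eqP => [e|_]; [lia|exact: a].
have [u1 v1] := H z D1; have [u2 v2] := H _ D2; have f := F n1 z.
case: Hn1 => h; have h1 := h _ a; have h2 := h _ a2.
  by apply: f.1 (u2 h2) _; exact: u1.
by apply: (v2 h2); apply: f.2; exact: v1.
Qed.
End Baire.

(** * The infinite board and its limit points *)

Section MartinMonk.
Variables (S : Type) (W : ultra S) (X : Type) (word : X -> S) (close : nat -> X -> X -> Prop).
Hypothesis close_sym : forall c x y, close c x y -> close c y x.
Hypothesis close_trans : forall c x y w, close c x y -> close c y w -> close c x w.
Hypothesis close_le : forall c d x y, c <= d -> close d x y -> close c x y.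
Hypothesis close_word : forall x y, close 0 x y <-> word x = word y.
Hypothesis close_sep : forall x y, (forall c, close c x y) -> x = y.
Hypothesis close_complete : forall y : nat -> X,
  (forall c d, c <= d -> close c (y c) (y d)) -> exists x, forall c, close c x (y c).
Variable x0 : X.

Variables (f : nat -> bool -> X -> X) (G : nat -> bool -> S -> S).
Hypothesis fG : forall n b x, word (f n b x) = G n b (word x).
Hypothesis Gc : forall n b, Econtr W (G n b).
Hypothesis Gl : forall n b, leaving W (G n b).
Hypothesis f_close : forall n b c x y, close c x y ->
  close (c + (isolev W (word (f n b x)) <= isolev W (word x))) (f n b x) (f n b y).

Implicit Types z : nat -> bool.

(** Row [n] of the board when row [n + m] is replaced by the arbitrary point [x0]; the bit [z n]
    selects the strategy producing row [n]. *)
Fixpoint comp_from z m n : X := if m is m'.+1 then f n (z n) (comp_from z m' n.+1) else x0.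

Lemma comp_from_agree z z' m n : bagree (n + m) z z' -> comp_from z m n = comp_from z' m n.
Proof.
elim: m n => //= m IH n a; rewrite IH; last by move=> i ii; apply: a; lia.
by rewrite a //; lia.
Qed.

Lemma comp_from_eqlevD z m d n : eqlev W m (word (comp_from z m n)) (word (comp_from z (m + d) n)).
Proof.
elim: m n => [|m IH] n; first exact: E_0.
by rewrite addSn /= !fG; apply: Gc; exact: IH.
Qed.

Lemma comp_from_eqlev z m m' n : m <= m' -> eqlev W m (word (comp_from z m n)) (word (comp_from z m' n)).
Proof. by move=> h; have := comp_from_eqlevD z m (m' - m) n; rewrite subnKC. Qed.

(* Either the words one board further stay in the cone, and then [G] leaves it,
   or they leave the cone and stabilise. *)
Lemma comp_from_word z n : exists M s, forall z' m, bagree M z z' -> M <= m -> word (comp_from z' m n) = s.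
Proof.
case: (pselect (forall m, cone W m (word (comp_from z m n.+1)))) => [HC|/existsNP[m0 nC0]].
  have [j [s Hj]] := Gl n (z n).
  exists (n + j).+2, s => z' [//|m] a jm /=; rewrite fG -a; last lia.
  apply: Hj; have jm' : j <= m by lia.
  apply: (E_C (HC j)); rewrite (@comp_from_agree z z'); first exact: comp_from_eqlev.
  by move=> i ii; apply: a; lia.
pose k := isolev W (word (comp_from z m0 n.+1)); pose M := maxn m0 k.
exists (n + M).+2, (G n (z n) (word (comp_from z M n.+1))) => z' [//|m] a jm /=.
rewrite fG -a; last lia.
congr G; symmetry; apply: (E_iso (u0 := W)).
have m0M : m0 <= M by exact: leq_maxl.
rewrite -(nC_K nC0 (comp_from_eqlev z n.+1 m0M)) -/k (@comp_from_agree z z' M); last by move=> i ii; apply: a; lia.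
apply: (@E_le _ W k M); first exact: leq_maxr.
by apply: comp_from_eqlev; lia.
Qed.

(* The tail functions contract unless [isolev] drops, which cannot happen forever. *)
Lemma comp_from_close c z n : exists M y, forall z' m, bagree M z z' -> M <= m -> close c (comp_from z' m n) y.
Proof.
elim: c n => [|c IHc] n.
  have [M [s HM]] := comp_from_word z n; exists M, (comp_from z M n) => z' m a h; apply/close_word.
  by rewrite !HM.
have [M0 [s HM0]] := comp_from_word z n.
move: {2}(isolev W s) (leqnn (isolev W s)) => k; elim: k n M0 s HM0 => [|k IHk] n M0 s HM0 ks.
  (* Level 0 isolates no word, since cone 0 contains them all. *)
  have [v0 Cv0] := C_ex W 0; exfalso; apply: (nC (u0 := W) (u := s)).
  by move: ks; rewrite leqn0 => /eqP ->; apply: (E_C Cv0); exact: E_0.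
have [M1 [s1 HM1]] := comp_from_word z n.+1.
case: (leqP (isolev W s) (isolev W s1)) => hK.
  have [M [y HM]] := IHc n.+1.
  pose MM := maxn M (maxn M0 (maxn M1 n.+1)).
  exists MM.+1, (f n (z n) y) => z' [//|m] a h.
  have [h1 h2 h3 h4] : [/\ M <= MM, M0 <= MM, M1 <= MM & n.+1 <= MM].
    by rewrite /MM; split; lia.
  have ws : word (comp_from z' m.+1 n) = s by apply: HM0; [move=> i ii; apply: a; lia | lia].
  have ws1 : word (comp_from z' m n.+1) = s1 by apply: HM1; [move=> i ii; apply: a; lia | lia].
  have cl : close c (comp_from z' m n.+1) y by apply: HM; [move=> i ii; apply: a; lia | lia].
  have := f_close n (z' n) cl; rewrite -/(comp_from z' m.+1 n) ws ws1 hK addn1.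
  by rewrite -(a n) //; lia.
have [|M [y HM]] := IHk n.+1 M1 s1 HM1; first lia.
pose MM := maxn M n.+1.
exists MM.+1, (f n (z n) y) => z' [//|m] a h.
have [h1 h4] : M <= MM /\ n.+1 <= MM by rewrite /MM; lia.
have cl : close c.+1 (comp_from z' m n.+1) y by apply: HM; [move=> i ii; apply: a; lia | lia].
have := f_close n (z' n) cl; rewrite -/(comp_from z' m.+1 n) -(a n); last lia.
apply: close_le; lia.
Qed.

Lemma comp_from_limit z n : exists x, forall c, exists M, forall z' m, bagree M z z' -> M <= m ->
  close c (comp_from z' m n) x.
Proof.
have /choice[M /choice[y H]] := fun c => comp_from_close c z n.
have [|x Hx] := close_complete (y := y).
  move=> c d cd; pose m := maxn (M c) (M d).
  apply: (@close_trans _ _ (comp_from z m n)); first by apply: close_sym; apply: H => //; exact: leq_maxl.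
  by apply: close_le cd _; apply: H => //; exact: leq_maxr.
exists x => c; exists (M c) => z' m a h; apply: (@close_trans _ _ (y c)); first exact: H.
by apply: close_sym; exact: Hx.
Qed.

Definition limpt z n : X := sval (cid (comp_from_limit z n)).
Lemma limptP z n c : exists M, forall z' m, bagree M z z' -> M <= m -> close c (comp_from z' m n) (limpt z n).
Proof. exact: (svalP (cid (comp_from_limit z n))). Qed.

Lemma limpt_step z n : limpt z n = f n (z n) (limpt z n.+1).
Proof.
apply: close_sep => c; have [M1 H1] := limptP z n c; have [M2 H2] := limptP z n.+1 c.
pose m := maxn M1 M2.
apply: (@close_trans _ _ (comp_from z m.+1 n)).
  by apply: close_sym; apply: H1 => //; rewrite leqW // leq_maxl.
have cl : close c (comp_from z m n.+1) (limpt z n.+1) by apply: H2 => //; exact: leq_maxr.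
by apply: close_le (f_close n (z n) cl); exact: leq_addr.
Qed.

Lemma limpt_cont z n c : exists M, forall z', bagree M z z' -> close c (limpt z n) (limpt z' n).
Proof.
have [M H] := limptP z n c; exists M => z' a; have [M' H'] := limptP z' n c.
pose m := maxn M M'; apply: (@close_trans _ _ (comp_from z' m n)).
  by apply: close_sym; apply: H => //; exact: leq_maxl.
by apply: H' => //; exact: leq_maxr.
Qed.

Lemma limpt_dep z z' n : (forall i, n <= i -> z i = z' i) -> limpt z n = limpt z' n.
Proof.
move=> e.
have ppe m k : n <= k -> comp_from z m k = comp_from z' m k.
  elim: m k => //= m IH k nk; rewrite e // IH //; lia.
apply: close_sep => c; have [M H] := limptP z n c; have [M' H'] := limptP z' n c.
pose m := maxn M M'; apply: (@close_trans _ _ (comp_from z m n)).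
  by apply: close_sym; apply: H => //; exact: leq_maxl.
by rewrite ppe //; apply: H' => //; exact: leq_maxr.
Qed.

Variable A : nat -> X -> Prop.
Hypothesis fA : forall n b x, A n (f n b x) <-> if b then A n.+1 x else ~ A n.+1 x.

(** Rows from [k.+1] on do not see bit [k], which exchanges the two strategies producing row [k];
    the unchanged strategies of smaller index carry the change to row 0. *)
Lemma limpt_flip k z : A 0 (limpt (flip k z) 0) <-> ~ A 0 (limpt z 0).
Proof.
have base : A k (limpt (flip k z) k) <-> ~ A k (limpt z k).
  rewrite !(limpt_step _ k) !fA (@limpt_dep (flip k z) z k.+1); last first.
    by move=> i ki; rewrite /flip; case: eqP => // e; lia.
  rewrite /flip eqxx; case: (z k) => //=; by case: (pselect (A k.+1 (limpt z k.+1))); tauto.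
have down d : d <= k -> A (k - d) (limpt (flip k z) (k - d)) <-> ~ A (k - d) (limpt z (k - d)).
  elim: d => [|d IH] dk; first by rewrite subn0.
  have := IH (ltnW dk); rewrite (_ : k - d = (k - d.+1).+1); last lia.
  set n := k - d.+1 => H.
  rewrite !(limpt_step _ n) !fA (_ : flip k z n = z n); last by rewrite /flip /n; case: eqP => //; lia.
  by case: (z n) => //; case: (pselect (A n.+1 (limpt z n.+1))); tauto.
by have := down k (leqnn _); rewrite subnn.
Qed.
End MartinMonk.

(** * Borel sets of the product topology *)

Lemma open_sopen (O : set baire_space) : open O -> sopen O.
Proof.
move=> oO x Ox; apply: contrapT => H.
have /choice[y Hy] : forall n, exists y : baire_space, agree n x y /\ ~ O y.
  move=> n; apply: contrapT => H2; apply: H; exists n => y a.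
  by apply: contrapT => nO; apply: H2; exists y.
have cv : (y : nat -> baire_space) @ \oo --> (x : baire_space).
  apply/cvg_sup => i; apply/cvg_image.
    by rewrite eqEsubset; split=> v // _; exists (fun=> v).
  move=> U /nbhs_singleton Ui; exists ((fun f : baire_space => f i) @^-1` U).
    exists i.+1 => // n /= ni; rewrite /preimage /= -((Hy n).1 i ni); exact: Ui.
  by rewrite image_preimage // eqEsubset; split=> // v _; exists (fun=> v).
have [N _ HN] := cv O (open_nbhs_nbhs (conj oO (Ox : O (x : baire_space)))).
by have := HN N (leqnn N); exact: (Hy N).2.
Qed.

Lemma borel_set_borelN (A : set baire_space) : borel_set A -> borelN A.
Proof.
apply: smallest_sub => [|X oX]; last by apply: borelN_open; exact: open_sopen.
split.
- by apply: borelN_open.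
- by move=> X bX; rewrite setTD; exact: borelN_setC.
- move=> F bF; have -> : \bigcup_n F n = [set x | exists n, F n x].
    by apply/seteqP; split=> x [n]; [exists n | exists n].
  exact: borelN_bigcup.
Qed.

(** * The metric *)

Local Open Scope ring_scope.

Section Dbar.
Variable R : realType.
Implicit Types x y : baire_space.

Lemma pow2V_gt0 n : 0 < 2 ^- n :> R.
Proof. by rewrite invr_gt0 exprn_gt0. Qed.

Lemma pow2V_le m n : (2 ^- m <= 2 ^- n :> R) = (n <= m)%N.
Proof. by rewrite lef_pV2 ?posrE ?exprn_gt0 // ler_eXn2l // ltr1n. Qed.

Lemma pow2VD m n : 2 ^- (m + n) = 2 ^- m * 2 ^- n :> R.
Proof. by rewrite exprD invfM. Qed.

Lemma dbar_spec x y : (x = y /\ dbar R x y = 0) \/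
  exists m, [/\ dbar R x y = 2 ^- m, agree m x y & x m <> y m].
Proof.
rewrite /dbar; case: pselect => [ex|nex]; last first.
  left; split=> //; apply/funext => n; apply/eqP; apply: contrapT => h.
  by apply: nex; exists n; apply/negP.
right; case: ex_minnP => m xm mmin; exists m; split=> //; last exact/eqP.
move=> i im; apply/eqP; apply: contrapT => /negP h.
by have := mmin i h; lia.
Qed.

Lemma dbar_agree x y n : agree n x y -> dbar R x y <= 2 ^- n.
Proof.
move=> a; have [[_ ->]|[m [-> _ ne]]] := dbar_spec x y; first exact/ltW/pow2V_gt0.
by rewrite pow2V_le leqNgt; apply/negP => mn; apply: ne; exact: a.
Qed.

Lemma dbar_head x y : x 0%N <> y 0%N -> dbar R x y = 1.
Proof.
move=> ne; have [[e _]|[[|m] [-> a _]]] := dbar_spec x y.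
- by rewrite e in ne.
- by rewrite expr0 invr1.
- by case: ne; exact: a.
Qed.

Lemma dbar_le1 x y : dbar R x y <= 1.
Proof. by have := @dbar_agree x y 0 (fun i => ltac:(done)); rewrite expr0 invr1. Qed.

End Dbar.

Section Phi.
Variables (R : realType) (phi e : nat -> R).
Hypothesis phi_gt0 : forall n, 0 < phi n.
Local Notation r := (inf (range phi)).
Hypothesis r_gt0 : 0 < r.
Hypothesis e_bij : set_bij [set: nat] (range phi) e.
Hypothesis e_dec : forall m n : nat, (e m < e n) = (n < m)%N.

Lemma r_le a : r <= phi a.
Proof. by apply: ge_inf; [exists 0 => _ [n _ <-]; exact/ltW | exists a]. Qed.

Lemma e_phi i : exists a, e i = phi a.
Proof.
have [a _ <-] : range phi (e i) by apply: (set_bij_sub e_bij); exists i.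
by exists a.
Qed.

Lemma phi_e a : exists i, phi a = e i.
Proof. by have [i _ <-] := set_bij_surj e_bij (ex_intro2 _ _ a I erefl : range phi (phi a)); exists i. Qed.

(** A strictly decreasing enumeration has no last term, so the infimum is not attained. *)
Lemma r_lt a : r < phi a.
Proof.
have [i ->] := phi_e a; have [b eb] := e_phi i.+1.
by apply: (le_lt_trans (r_le b)); rewrite -eb e_dec.
Qed.

Lemma e_small v : r < v -> exists i, e i < v.
Proof.
move=> rv; have [_ [a _ <-] h] : exists2 x, range phi x & x < v.
  by apply: inf_lt rv; exists (phi 0%N), 0%N.
by have [i ei] := phi_e a; exists i; rewrite -ei.
Qed.

Lemma pow2_small (a v : R) : 0 < v -> exists n, a * 2 ^- n < v.
Proof.
move=> v0; have [n hn] : exists n, a / v < n%:R.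
  exists (Num.bound `|a / v|); apply: le_lt_trans (ler_norm _) _; exact: archi_boundP.
exists n; rewrite ltr_pdivrMr ?exprn_gt0 // mulrC -ltr_pdivrMr //.
apply: (lt_le_trans hn); rewrite -natrX ler_nat.
by apply: ltnW; exact: ltn_expl.
Qed.

(** * Ranks of the distances above [r] *)

Definition above (v : R) : set (nat * nat) := [set p | v < e p.1 * 2 ^- p.2].

(** Both [e j] and [e 0 * 2 ^- m] must exceed [v], which leaves finitely many [j] and [m]. This
    gives the distances above [r] order type omega*. *)
Lemma above_finite v : r < v -> finite_set (above v).
Proof.
move=> rv; have [i ei] := e_small rv; have [n en] := pow2_small (e 0%N) (lt_trans r_gt0 rv).
apply: (@sub_finite_set _ _ (`I_i `*` `I_n)); last exact: finite_setX.
have e0 k : 0 < e k by have [a ->] := e_phi k.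
move=> [j m] /= h; split=> /=; rewrite ltnNge; apply/negP => le.
  have := lt_trans ei h; rewrite ltNge => /negP; apply.
  apply: (@le_trans _ _ (e j)).
    by apply: ler_piMr; [exact: ltW | rewrite invf_le1 ?exprn_gt0 // exprn_ege1 // ler1n].
  by rewrite leNgt e_dec -leqNgt.
have := lt_trans en h; rewrite ltNge => /negP; apply.
apply: ler_pM; [exact/ltW | exact/ltW/pow2V_gt0 | by rewrite leNgt e_dec | by rewrite pow2V_le].
Qed.

(* Pairs are counted with multiplicity; only the strict monotonicity of [rank] on
   the distances above [r] matters. *)
Definition rank (v : R) : nat := #|` fset_set (above v)|.

Lemma rank_anti v w : r < v -> v <= w -> (rank w <= rank v)%N.
Proof.
move=> rv vw; apply: fsubset_leq_card; rewrite -fset_set_sub.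
- by move=> p /=; exact: le_lt_trans.
- by apply: above_finite; exact: lt_le_trans vw.
- exact: above_finite.
Qed.

Lemma rank_lt v a n : r < v -> v < phi a * 2 ^- n -> (rank (phi a * 2 ^- n) < rank v)%N.
Proof.
move=> rv vw; have [i ei] := phi_e a; set w := phi a * _ in vw *.
have rw : r < w by exact: lt_trans vw.
apply: fproper_ltn_card; rewrite fproperEneq; apply/andP; split; last first.
  rewrite -fset_set_sub; [|exact: above_finite..].
  by move=> p /=; exact: lt_trans.
apply/eqP => /fset_set_inj E; have : above v (i, n) by rewrite /above /= -ei.
rewrite -E; [|exact: above_finite..].
by rewrite /above /= -ei ltxx.
Qed.

Lemma rank_le v a n : r < v -> (rank v <= rank (phi a * 2 ^- n))%N -> phi a * 2 ^- n <= v.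
Proof. by move=> rv h; rewrite leNgt; apply/negP => /(rank_lt rv); lia. Qed.

Lemma N_ex a : exists n, phi a * 2 ^- n <= r.
Proof. by have [n h] := pow2_small (phi a) r_gt0; exists n; exact: ltW. Qed.

Definition N a := ex_minn (N_ex a).

Lemma NP a n : (phi a * 2 ^- n <= r) = (N a <= n)%N.
Proof.
rewrite /N; case: ex_minnP => m hm mmin; apply/idP/idP => [/mmin//|mn].
apply: le_trans hm; rewrite ler_pM2l //; by rewrite pow2V_le.
Qed.

Lemma N_gt0 a : (0 < N a)%N.
Proof. by rewrite ltnNge -NP expr0 invr1 mulr1 -ltNge r_lt. Qed.

Lemma r_lt_N a n : (n < N a)%N -> r < phi a * 2 ^- n.
Proof. by rewrite ltNge NP -ltnNge. Qed.

Lemma rank_phi_anti a m n : (m <= n)%N -> (n < N a)%N ->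
  (rank (phi a * 2 ^- m) <= rank (phi a * 2 ^- n))%N.
Proof.
move=> mn nN; apply: rank_anti; first exact: r_lt_N.
by rewrite ler_pM2l // pow2V_le.
Qed.

(* The word of [x] is the initial segment of length [N (x 0)]: two points have the
   same word iff their distance is at most [r]. *)
Definition wtype := {w : seq nat | size w == N (head 0%N w)}.
Implicit Types (w u v : wtype) (x y : nat -> nat).

Definition hd w := head 0%N (val w).
Definition ltr w n := nth 0%N (val w) n.

Lemma size_w w : size (val w) = N (hd w).
Proof. exact/eqP/(valP w). Qed.

Lemma word_proof x : size (mkseq x (N (x 0%N))) == N (head 0%N (mkseq x (N (x 0%N)))).
Proof. by rewrite size_mkseq -nth0 nth_mkseq ?N_gt0. Qed.
Definition word x : wtype := exist _ (mkseq x (N (x 0%N))) (word_proof x).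
Definition tail x : nat -> nat := fun i => x (N (x 0%N) + i)%N.
Definition glue w (t : nat -> nat) : nat -> nat :=
  fun n => if (n < N (hd w))%N then ltr w n else t (n - N (hd w))%N.

Lemma hd_word x : hd (word x) = x 0%N.
Proof. by rewrite /hd /= -nth0 nth_mkseq ?N_gt0. Qed.

Lemma ltr_word x n : (n < N (x 0%N))%N -> ltr (word x) n = x n.
Proof. by move=> h; rewrite /ltr /= nth_mkseq. Qed.

Lemma ltr0 w : ltr w 0 = hd w.
Proof. by rewrite /ltr nth0. Qed.

Lemma word_eq u v : hd u = hd v -> (forall n, (n < N (hd u))%N -> ltr u n = ltr v n) -> u = v.
Proof.
move=> h H; apply: val_inj; apply: (@eq_from_nth _ 0%N); first by rewrite !size_w h.
by move=> i; rewrite size_w; exact: H.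
Qed.

Lemma glue0 w t : glue w t 0%N = hd w.
Proof. by rewrite /glue N_gt0 ltr0. Qed.

Lemma word_glue w t : word (glue w t) = w.
Proof.
apply: word_eq; rewrite hd_word glue0 // => n nN.
by rewrite ltr_word ?glue0 // /glue nN.
Qed.

Lemma tail_glue w t : tail (glue w t) = t.
Proof. by apply/funext => i; rewrite /tail glue0 /glue ltnNge leq_addr addKn. Qed.

Lemma glue_word x : glue (word x) (tail x) = x.
Proof.
apply/funext => n; rewrite /glue hd_word; case: ltnP => h; first exact: ltr_word.
by rewrite /tail subnKC.
Qed.

(** With [k = rank v] this means distance at most [v]: different first letters are as far apart as
    the larger value of [phi], otherwise the first differing letter counts. *)
Definition wE k u v := (k <= rank (phi (hd u)) /\ k <= rank (phi (hd v)))%N \/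
  (hd u = hd v /\ forall n, (n < N (hd u))%N -> (rank (phi (hd u) * 2 ^- n) < k)%N -> ltr u n = ltr v n).
(** One past the rank of the smallest distance from [w] to another word. *)
Definition wK w := (rank (phi (hd w) * 2 ^- (N (hd w)).-1)).+1.
Definition wC k w := (k <= rank (phi (hd w)))%N.

Lemma wE_refl k u : wE k u u. Proof. by right. Qed.
Lemma wE_sym k u v : wE k u v -> wE k v u.
Proof.
case=> [[h1 h2]|[h H]]; first by left.
by right; split=> // n; rewrite -h => n1 n2; rewrite H.
Qed.
Lemma wE_trans k u v w : wE k u v -> wE k v w -> wE k u w.
Proof.
case=> [[h1 h2]|[h H]] [[h1' h2']|[h' H']].
- by left.
- by left; rewrite -h'.
- by left; rewrite h.
- right; split; first by rewrite h.
  by move=> n n1 n2; rewrite H // H' -?h.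
Qed.
Lemma wE_le j k u v : (j <= k)%N -> wE k u v -> wE j u v.
Proof.
move=> jk [[h1 h2]|[h H]]; first by left; split; lia.
by right; split=> // n n1 n2; apply: H => //; lia.
Qed.
Lemma wE_0 u v : wE 0 u v. Proof. by left. Qed.

Lemma rank_phi_lt_K w : (rank (phi (hd w)) < wK w)%N.
Proof.
have := @rank_phi_anti (hd w) 0 (N (hd w)).-1; rewrite expr0 invr1 mulr1 /wK ltnS; apply=> //.
by rewrite prednK // N_gt0.
Qed.

Lemma wE_iso u v : wE (wK u) u v -> u = v.
Proof.
case=> [[h _]|[h H]]; first by have := rank_phi_lt_K u; lia.
apply: word_eq => // n nN; apply: H => //; rewrite ltnS; apply: rank_phi_anti; have := N_gt0 (hd u); lia.
Qed.
Lemma wC_le j k u : (j <= k)%N -> wC k u -> wC j u. Proof. by rewrite /wC; lia. Qed.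
Lemma wC_ex k : exists u, wC k u.
Proof.
suff [a ha] : exists a, (k <= rank (phi a))%N.
  by exists (word (fun=> a)); rewrite /wC hd_word.
elim: k => [|k [a ha]]; first by exists 0%N.
have [i ei] := phi_e a; have [b eb] := e_phi i.+1; exists b; apply: (leq_ltn_trans ha).
have := @rank_lt (phi b) a 0 (r_lt b); rewrite expr0 invr1 mulr1; apply.
by rewrite ei -eb e_dec.
Qed.
Lemma wC_E k u v : wC k u -> wC k v -> wE k u v. Proof. by left. Qed.
Lemma wE_C k u v : wC k u -> wE k u v -> wC k v.
Proof. by move=> h [[]//|[e' _]]; rewrite /wC -e'. Qed.
Lemma wnC_K k u v : ~ wC k u -> wE k u v -> wK u = wK v.
Proof. by move=> h [[]//|[e' _]]; rewrite /wK e'. Qed.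
Lemma wnC u : ~ wC (wK u) u.
Proof. by rewrite /wC; have := rank_phi_lt_K u; lia. Qed.
(** Once [phi a] is at most [2 * r], a single halving brings it down to [r], and the word is one
    letter. *)
Lemma wC_deep : exists k0, forall u, wC k0 u -> wC (wK u).-1 u.
Proof.
have r2 : r < 2 * r by rewrite mulr_natl mulr2n ltrDl.
have [i ei] := e_small r2; have [a ea] := e_phi i.
exists (rank (phi a)) => u; rewrite /wC => h.
have {h} h : phi (hd u) <= phi a.
  by have := @rank_le (phi a) (hd u) 0 (r_lt a); rewrite expr0 invr1 mulr1; exact.
have N1 : N (hd u) = 1%N.
  apply/eqP; rewrite eqn_leq N_gt0 andbT -NP expr1 ler_pdivrMr // mulrC.
  by apply: (le_trans h); rewrite -ea ltW.
by rewrite /wK N1 /= expr0 invr1 mulr1.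
Qed.

Definition words : ultra wtype := Ultra wE_refl wE_sym wE_trans wE_le wE_0 wE_iso
  wC_le wC_ex wC_E wE_C wnC_K wnC wC_deep.

(** * Nonexpansive maps from word maps and tail maps *)

Lemma dphi_head (x y : baire_space) : x 0%N <> y 0%N -> dphi phi x y = Num.max (phi (x 0%N)) (phi (y 0%N)).
Proof. by move=> h; rewrite /dphi dbar_head // mulr1. Qed.

Lemma dphi_same (x y : baire_space) : x 0%N = y 0%N -> dphi phi x y = phi (x 0%N) * dbar R x y.
Proof. by move=> h; rewrite /dphi -h maxxx. Qed.

Lemma dphi_word (x y : baire_space) : word x <> word y -> r < dphi phi x y /\
  wE (rank (dphi phi x y)) (word x) (word y).
Proof.
move=> ne; case: (eqVneq (x 0%N) (y 0%N)) => [h|/eqP h].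
  rewrite dphi_same //; have [[e' _]|[m [-> a nem]]] := dbar_spec R x y; first by rewrite e' in ne.
  have mN : (m < N (x 0%N))%N.
    rewrite ltnNge; apply/negP => Nm; apply: ne; apply: word_eq; rewrite !hd_word // => n nN.
    rewrite !ltr_word -?h //; apply: a; lia.
  split; first exact: r_lt_N.
  right; rewrite !hd_word; split=> // n nN hr; rewrite !ltr_word -?h //; apply: a.
  rewrite ltnNge; apply/negP => mn.
  by have := rank_phi_anti mn nN; lia.
rewrite dphi_head //; have rx := r_lt (x 0%N); have ry := r_lt (y 0%N).
split; first by rewrite lt_max rx.
by left; rewrite !hd_word; split; apply: rank_anti => //; rewrite le_max lexx ?orbT.
Qed.

Lemma dphi_wE (x y : baire_space) (v : R) : r < v -> wE (rank v) (word x) (word y) -> dphi phi x y <= v.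
Proof.
move=> rv.
have rk a : (rank v <= rank (phi a))%N -> phi a <= v.
  by have := @rank_le v a 0 rv; rewrite expr0 invr1 mulr1.
case=> [[/rk h1 /rk h2]|[h H]].
  rewrite !hd_word in h1 h2; apply: (@le_trans _ _ (Num.max (phi (x 0%N)) (phi (y 0%N)))).
    by rewrite /dphi ler_piMr ?dbar_le1 // le_max ltW.
  by rewrite ge_max h1.
rewrite !hd_word in h H; rewrite dphi_same //.
have [[_ ->]|[m [-> _ ne]]] := dbar_spec R x y; first by rewrite mulr0 ltW // (lt_trans r_gt0).
rewrite leNgt; apply/negP => lt; apply: ne.
have mN : (m < N (x 0%N))%N by rewrite ltnNge -NP -ltNge (lt_trans rv).
by have := H m mN (rank_lt rv lt); rewrite !ltr_word -?h.
Qed.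

Definition wfun (F : wtype -> wtype) (h : wtype -> (nat -> nat) -> nat -> nat) (x : baire_space) : baire_space :=
  glue (F (word x)) (h (word x) (tail x)).

Lemma Lipn_le d d' h : (d <= d')%N -> Lipn d' h -> Lipn d h.
Proof. by move=> dd H n x y a i ii; apply: (H n x y a); lia. Qed.

Lemma wfun_nonexpansive F h : Epres words F -> (forall w, Lipn (wK (F w) < wK w)%N (h w)) ->
  nonexpansive phi (wfun F h).
Proof.
move=> EF Lh x y; case: (pselect (word x = word y)) => [ew|nw]; last first.
  have [rd Ed] := dphi_word nw; apply: dphi_wE => //.
  by rewrite /wfun !word_glue; exact: (EF _ _ _ Ed).
have h0 : x 0%N = y 0%N by rewrite -!hd_word ew.
rewrite [leRHS]dphi_same // dphi_same; last by rewrite /wfun !glue0 ew.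
have [[-> ->]|[m [-> a ne]]] := dbar_spec R x y.
  have [[_ ->]|[m' [_ _ []]]] := dbar_spec R (wfun F h y) (wfun F h y) => //.
  by rewrite !mulr0.
set w := word x in ew; have hw : hd w = x 0%N by exact: hd_word.
have Nm : (N (hd w) <= m)%N.
  rewrite leqNgt; apply/negP => mN; apply: ne; rewrite hw in mN.
  by rewrite -(ltr_word mN) -/w ew ltr_word // -h0.
set d := (wK (F w) < wK w)%N.
have aw : agree (N (hd (F w)) + (m - N (hd w)) + d) (wfun F h x) (wfun F h y).
  move=> i ii; rewrite /wfun -/w -ew /glue; case: ltnP => // Ni.
  apply: (Lh w (m - N (hd w))%N); last by rewrite -/d; lia.
  by move=> j jj; rewrite /tail -h0 -hw; apply: a; lia.
rewrite {1}/wfun glue0 -/w -hw.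
apply: (@le_trans _ _ (phi (hd (F w)) * 2 ^- (N (hd (F w)) + (m - N (hd w)) + d))).
  by rewrite ler_pM2l // dbar_agree.
have -> : phi (hd w) * 2 ^- m = phi (hd w) * 2 ^- N (hd w) * 2 ^- (m - N (hd w)).
  by rewrite -{1}(subnKC Nm) pow2VD mulrA.
rewrite addnAC !pow2VD !mulrA ler_pM2r ?pow2V_gt0 //.
have half (b : nat) : 2 ^- (N b).-1 = 2 * 2 ^- (N b) :> R.
  have := N_gt0 b; case: (N b) => //= n _; rewrite exprS invfM mulrA divff ?mul1r // pnatr_eq0.
(* If [d] is true, the image unit is at most [r] and the source unit above [r / 2], so the extra
   halving suffices; otherwise the ranks compare the units directly. *)
rewrite /d; case: ltnP => hK.
  rewrite expr1; apply: (@le_trans _ _ (r / 2)).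
    by rewrite ler_pM2r ?invr_gt0 // NP.
  have := @r_lt_N (hd w) (N (hd w)).-1; rewrite prednK ?N_gt0 // leqnn => /(_ isT).
  by rewrite half; lra.
rewrite expr0 invr1 mulr1; move: hK; rewrite /wK ltnS => hK.
have rv : r < phi (hd w) * 2 ^- (N (hd w)).-1 by apply: r_lt_N; rewrite prednK ?N_gt0.
by have := rank_le rv hK; rewrite !half mulrCA [leRHS]mulrCA ler_pM2l.
Qed.

(** * The dichotomy for a pair of Borel sets *)

Section Pair.
Variables A B : set baire_space.
Hypotheses (bA : borelN A) (bB : borelN B).

(* Distances between points with the same word [w] are the powers of [1/2] scaled by
   [phi (hd w) * 2 ^- N (hd w)], which lies in [(r/2, r]] and decreases with [wK w]. *)
Definition tailred w w' := exists h, Lipn (wK w' < wK w)%N h /\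
  forall t, A (glue w t) <-> B (glue w' (h t)).

Lemma borelN_glue X w : borelN X -> borelN [set t | X (glue w t)].
Proof.
apply: borelN_preimage => x n; exists n => y a i ii; rewrite /glue; case: ltnP => // _.
by apply: a; lia.
Qed.

(** Where a reduction would have to contract, Wadge's lemma is applied with the sets exchanged and
    one complemented, so that its contracting alternative is the excluded one. *)
Lemma not_tailred w w' : ~ tailred w w' -> exists h, Lipn (wK w <= wK w')%N h /\
  forall t, B (glue w' t) <-> ~ A (glue w (h t)).
Proof.
move=> nP; case: (ltnP (wK w') (wK w)) => hK.
  have bnA := borelN_setC (borelN_glue w bA).
  have [//|[h [Lh H]]] := Lipschitz_det (borelN_glue w' bB) bnA.
  exfalso; apply: nP; exists h; rewrite hK; split=> // t; have := H t; rewrite /setC /=.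
  by case: (pselect (A (glue w t))); case: (pselect (B (glue w' (h t)))); tauto.
have [[h [Lh H]]|//] := Lipschitz_det (borelN_glue w bA) (borelN_glue w' bB).
by exfalso; apply: nP; exists h; rewrite ltnNge hK.
Qed.

Lemma reduction_dichotomy : reducible phi A B \/ exists G g,
  [/\ Econtr words G, leaving words G, forall w, Lipn (wK (G w) <= wK w)%N (g w) &
      forall x, B x <-> ~ A (wfun G g x)].
Proof.
have [[F [EF PF]]|[G [cG lG nP]]] := dichotomy words tailred; [left|right].
  have /choice[h Hh] := PF.
  exists (wfun F h); split; first by apply: wfun_nonexpansive => // w; exact: (Hh w).1.
  apply/seteqP; split=> x Hx; have := (Hh (word x)).2 (tail x); rewrite glue_word => E.
    exact: E.1.
  exact: E.2.
have /choice[g Hg] := fun w => not_tailred (nP w).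
exists G, g; split=> // [w|x]; first exact: (Hg w).1.
by rewrite -{1}(glue_word x); exact: (Hg _).2.
Qed.

Lemma Econtr_Epres G : Econtr words G -> Epres words G.
Proof. by move=> cG k u v /cG; exact: (@wE_le k k.+1). Qed.

Lemma reducible_SLO : reducible phi A B \/ reducible phi (~` B) A.
Proof.
have [|[G [g [cG _ Lg H]]]] := reduction_dichotomy; [by left | right].
exists (wfun G g); split.
  apply: wfun_nonexpansive => [|w]; first exact: Econtr_Epres.
  by apply: Lipn_le (Lg w); case: ltngtP.
apply/seteqP; split=> x; rewrite /preimage /setC /=; have := H x;
  by case: (pselect (A (wfun G g x))); tauto.
Qed.
End Pair.

(** * Well-foundedness *)

Lemma reducible_trans A B D : reducible phi A B -> reducible phi B D -> reducible phi A D.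
Proof.
move=> [f [nf ->]] [g [ng ->]]; exists (g \o f); split=> // x y /=.
exact: le_trans (ng _ _) (nf _ _).
Qed.

Lemma reducible_setC A B : reducible phi A B -> reducible phi (~` A) (~` B).
Proof. by move=> [f [nf ->]]; exists f. Qed.

Definition close c x y := word x = word y /\ agree c (tail x) (tail y).

Lemma close_complete (y : nat -> nat -> nat) :
  (forall c d, (c <= d)%N -> close c (y c) (y d)) -> exists x, forall c, close c x (y c).
Proof.
move=> H; exists (glue (word (y 0%N)) (fun i => tail (y i.+1) i)) => c.
rewrite /close word_glue tail_glue; split; first exact: (H 0%N c (leq0n c)).1.
by move=> i ic; exact: (H i.+1 c ic).2.
Qed.

Lemma close_agree c x y : close c x y -> agree c x y.
Proof.
move=> [e1 e2] i ic; rewrite -(glue_word x) -(glue_word y) -e1 /glue; case: ltnP => // _.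
by apply: e2; lia.
Qed.

Lemma no_descending (A : nat -> set baire_space) : (forall n, borelN (A n)) ->
  ~ (forall n, strictly_reducible phi (A n.+1) (A n)).
Proof.
move=> bA SA.
have dich n (b : bool) : exists Gg : (wtype -> wtype) * (wtype -> (nat -> nat) -> nat -> nat),
  [/\ Econtr words Gg.1, leaving words Gg.1, forall w, Lipn (wK (Gg.1 w) <= wK w)%N (Gg.2 w) &
      forall x, A n (wfun Gg.1 Gg.2 x) <-> if b then A n.+1 x else ~ A n.+1 x].
  have [r1 nr1] := SA n.
  (* Such a reduction would give a chain from [A n] through the complement of [A n.+1] and the
     complement of [A n] to [A n.+1]. *)
  have nr2 : ~ reducible phi (A n) (~` A n.+1).
    move=> r2; apply: nr1; apply: (reducible_trans r2).
    have r3 : reducible phi (~` A n) (A n.+1) by have := reducible_setC r2; rewrite setCK.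
    apply: reducible_trans (reducible_setC r1) r3.
  (* For [true] the game is played against the complement of [A n.+1], which makes I's equivalence
     positive. *)
  case: b.
    have [//|[G [g [cG lG Lg H]]]] := reduction_dichotomy (bA n) (borelN_setC (bA n.+1)).
    exists (G, g); split=> // x /=; have := H x; rewrite /setC /=.
    by case: (pselect (A n (wfun G g x))); case: (pselect (A n.+1 x)); tauto.
  have [//|[G [g [cG lG Lg H]]]] := reduction_dichotomy (bA n) (bA n.+1).
  exists (G, g); split=> // x /=; have := H x.
  by case: (pselect (A n (wfun G g x))); case: (pselect (A n.+1 x)); tauto.
have /choice[Gg HGg] : forall nb : nat * bool, exists Gg : (wtype -> wtype) * (wtype -> (nat -> nat) -> nat -> nat),
  [/\ Econtr words Gg.1, leaving words Gg.1, forall w, Lipn (wK (Gg.1 w) <= wK w)%N (Gg.2 w) &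
      forall x, A nb.1 (wfun Gg.1 Gg.2 x) <-> if nb.2 then A nb.1.+1 x else ~ A nb.1.+1 x].
  by move=> [n b]; exact: dich.
pose G n b := (Gg (n, b)).1; pose f n b : (nat -> nat) -> nat -> nat := wfun (G n b) (Gg (n, b)).2.
have Gc n b : Econtr words (G n b) by case: (HGg (n, b)).
have Gl n b : leaving words (G n b) by case: (HGg (n, b)).
have fA n b x : A n (f n b x) <-> if b then A n.+1 x else ~ A n.+1 x by have [_ _ _] := HGg (n, b); exact.
have fG n b x : word (f n b x) = G n b (word x) by rewrite /f /wfun word_glue.
have f_close n b c x y : close c x y ->
    close (c + (isolev words (word (f n b x)) <= isolev words (word x))%N) (f n b x) (f n b y).
  move=> [ew a]; rewrite /close !fG ew; split=> //.
  rewrite /f /wfun !tail_glue ew; have [_ _ Lg _] := HGg (n, b); exact: (Lg (word y) c _ _ a).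
have c_sym c x y : close c x y -> close c y x.
  by move=> [e1 e2]; split=> // i ii; rewrite e2.
have c_tr c x y t : close c x y -> close c y t -> close c x t.
  by move=> [e1 e2] [e3 e4]; split=> [|i ii]; [rewrite e1 | rewrite e2 // e4].
have c_le c d x y : (c <= d)%N -> close d x y -> close c x y.
  by move=> cd [e1 e2]; split=> // i ii; apply: e2; lia.
have c_w x y : close 0 x y <-> word x = word y by split=> [[]//|h]; split.
have c_sep x y : (forall c, close c x y) -> x = y.
  by move=> H; apply/funext => i; apply: (close_agree (H i.+1)).
pose X z := limpt (W := words) c_sym c_tr c_le c_w close_complete (fun=> 0%N) fG Gc Gl f_close z 0.
have Xc z n : exists m, forall z', bagree m z z' -> agree n (X z) (X z').
  have [M HM] := limpt_cont c_sym c_tr c_le c_w close_complete (fun=> 0%N) fG Gc Gl f_close z 0 n.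
  by exists M => z' a; exact: (close_agree (HM z' a)).
apply: (no_flip_set (baire_prop_preimage Xc (bA 0%N))) => k z /=.
exact: (limpt_flip _ _ _ _ c_sep _ _ _ _ _ _ fA).
Qed.

End Phi.

Theorem theorem4p10 (R : realType) (phi : nat -> R)
    (phi_gt0 : forall n, 0 < phi n)
    (phi_inj : injective phi)
    (inf_phi_gt0 : 0 < inf (range phi))
    (range_phi : order_type_omega_star (range phi)) :
  very_good_on_borel phi.
Proof.
have [e [e_bij e_dec]] := range_phi; split.
  move=> A B /borel_set_borelN bA /borel_set_borelN bB.
  exact: (reducible_SLO phi_gt0 inf_phi_gt0 e_bij e_dec bA bB).
move=> [A [bA SA]]; apply: (no_descending phi_gt0 inf_phi_gt0 e_bij e_dec _ SA) => n.
exact: borel_set_borelN.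
Qed.
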